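(* Let $m\geq 0$ and $p\geq 1$ be integers, let $w:=m+p+2$, and $|k|_l:=k_1+\cdots+k_l$. Then \[ \sum_{n=1}^\infty\frac{H_n\zeta_n^\star(\{1\}_m)\binom{2n}{n}}{4^n n} =-2^{m+1}\sum_{k=1}^{m+1}\zeta(\bar{k},\widetilde{m+2-k})+2^{m+1}(m+1)\zeta(\widetilde{m+2})\,, \] and \[ \sum_{n=1}^\infty\frac{H_n\zeta_n^\star(\{1\}_m)\binom{2n}{n}}{4^n n^{p+1}} =-2^{m+1}\sum_{\substack{|k|_{p+1}\leq w-1\\k_1,\ldots,k_{p+1}\geq1}} \zeta\left(\bar{k}_{p+1},\widetilde{w-|k|_{p+1}},\hat{k}_1,\ldots,\hat k_p\right) +2^{m+1}\sum_{\substack{|k|_p\leq w-2\\k_1,\ldots,k_p\geq1}} (w-1-|k|_p)\,\zeta\left(\widetilde{w-|k|_p},\hat{k}_1,\ldots,\hat k_p\right)\,, \] where the sums run over integers $k_i\geq 1$.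
   Context: $H_n=\sum_{k=1}^n1/k$; $\zeta_n^\star(\{1\}_m):=\sum_{n\geq n_1\geq\cdots\geq n_m\geq 1}\frac{1}{n_1\cdots n_m}$, with $\zeta_n^\star(\emptyset)=1$. Mixed multiple zeta values: for positive integers $s_1,\dots,s_r$, each possibly decorated by a bar, hat or tilde, $\zeta(s_1,\dots,s_r):=\sum_{n_1>n_2>\cdots>n_r\geq 1}\prod_{j=1}^r \frac{\epsilon_j(n_j)}{n_j^{s_j}}$, where $\epsilon_j(n)=1$ for undecorated $s_j$, $(-1)^n$ for $\bar s_j$, $1+(-1)^n$ for $\hat s_j$, and $1-(-1)^n$ for $\tilde s_j$ (e.g. $\zeta(\tilde s)=\sum_{n\ge1}(1-(-1)^n)n^{-s}$). *)

(* Defs.v *)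
From HB Require Import structures.
From mathcomp Require Import all_boot all_order all_algebra.
From mathcomp Require Import all_classical all_reals all_analysis.

Set Implicit Arguments.
Unset Strict Implicit.
Unset Printing Implicit Defensive.

Import Order.TTheory GRing.Theory Num.Theory.
Import numFieldNormedType.Exports.

Local Open Scope ring_scope.

Definition harmonic_number (R : realType) (n : nat) : R :=
  \sum_(1 <= k < n.+1) k%:R^-1.

(* The tuple t lists n_1 - 1, ..., n_m - 1, so that 1 <= n_j <= n. *)
Definition zeta_star_ones (R : realType) (n m : nat) : R :=
  \sum_(t : m.-tuple 'I_n | sorted geq (map val t))
    \prod_(i <- t) i.+1%:R^-1.

Inductive entry : Type :=
  | Plain of nat | Bar of nat | Hat of nat | Tilde of nat.

Definition entry_factor (R : realType) (e : entry) (n : nat) : R :=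
  match e with
  | Plain s => 1 / n%:R ^+ s
  | Bar s   => (-1) ^+ n / n%:R ^+ s
  | Hat s   => (1 + (-1) ^+ n) / n%:R ^+ s
  | Tilde s => (1 - (-1) ^+ n) / n%:R ^+ s
  end.

(* Sum over N >= n_1 > ... > n_r >= 1; again t lists the n_j - 1. *)
Definition mzv_partial (R : realType) (s : seq entry) (N : nat) : R :=
  \sum_(t : (size s).-tuple 'I_N | sorted gtn (map val t))
    \prod_(x <- zip s t) entry_factor R x.1 x.2.+1.

(* The series may converge only conditionally (leading Bar 1); it is summed
   along the largest index n_1. The value is meaningful only when
   [mzv_converges] holds. *)
Definition mzv (R : realType) (s : seq entry) : R :=
  limn (mzv_partial R s).

Definition mzv_converges (R : realType) (s : seq entry) : Prop :=
  cvgn (mzv_partial R s).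

(* Partial sums of \sum_(n >= 1) H_n zeta*_n({1}_m) 'C(2n, n) / (4^n n^q). *)
Definition binomial_partial (R : realType) (m q N : nat) : R :=
  \sum_(1 <= n < N.+1)
    harmonic_number R n * zeta_star_ones R n m * 'C(2 * n, n)%:R
      / (4%:R ^+ n * n%:R ^+ q).

(* Tuples (k_1, ..., k_l) of positive integers with |k|_l <= b. Each k_i is
   then at most b, so letting the k_i range over 'I_b.+1 loses nothing. *)
Definition part_sum (b l : nat) (k : l.-tuple 'I_b.+1) : nat :=
  (\sum_(i <- k) i)%N.

Definition bounded_composition (b l : nat) (k : l.-tuple 'I_b.+1) : bool :=
  all (fun i : 'I_b.+1 => 0 < i)%N k && (part_sum k <= b)%N.

(* \bar k_(p+1), ~(w - |k|_(p+1)), \hat k_1, ..., \hat k_p *)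
Definition bar_word (w b p : nat) (k : p.+1.-tuple 'I_b.+1) : seq entry :=
  [:: Bar (tnth k ord_max), Tilde (w - part_sum k)
    & [seq Hat (nat_of_ord i) | i <- take p k]].

(* ~(w - |k|_p), \hat k_1, ..., \hat k_p *)
Definition tilde_word (w b p : nat) (k : p.-tuple 'I_b.+1) : seq entry :=
  Tilde (w - part_sum k) :: [seq Hat (nat_of_ord i) | i <- k].

(* Main.v *)
(** After multiplication by x^m and summation over m (|x| < 1/2), both sides become series of
positive terms.  Put b = 1 - x and let e_p(i) be the elementary sum of
1/((l_1 - x) ... (l_p - x)) over i >= l_1 > ... > l_p >= 1.  The weights 1/4^n 'C(2n, n) are
(1/2)_n / n!, the numbers zeta*_n({1}_m) have generating function n! / (b)_n, and, once the
powers of 2 are distributed, the claim is L + B = T with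
  L = sum_{n >= 1} H_n (1/2)_n / ((b)_n n^(p+1)),
  B = sum_{r >= 1} (1/(r - x) - 1/(r + 1/2 - x)) sum_{i < r} e_p(i) / (i + 1/2 - x),
  T = sum_{i >= 0} e_p(i) / (i + 1/2 - x)^2.
Exchanging the sums in B, T - B is the sum over i of e_p(i) / (i + 1/2 - x) times
sum_{r >= 0} (1/(i + r + 1/2 - x) - 1/(i + r + 1 - x)).  Expanding both factors with
  1/(c - a) = sum_{k >= 0} (a)_k / (c)_{k+1}
makes H_N appear as the sum of 1/k over k <= N, and
  sum_{i >= 0} e_p(i) / (b + i)_{N+1} = 1 / ((b)_N N^(p+1)),
which follows by induction on p from a telescoping sum, gives L.  Comparing coefficients of
power series with nonnegative coefficients yields the theorem, and the finiteness of T at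
x = 1/4 yields all convergence statements.  The only conditionally convergent ones, those with
a leading bar, are positive series along odd bounds, and consecutive partial sums get close
because the inner sums up to n are O(sqrt n). *)
Require Import Defs.
From HB Require Import structures.
From mathcomp Require Import all_boot all_order all_algebra.
From mathcomp Require Import all_classical all_reals all_analysis.
From mathcomp Require Import ring lra zify.

Import Order.TTheory GRing.Theory Num.Theory.
Import numFieldNormedType.Exports.

Local Open Scope classical_set_scope.
Local Open Scope ring_scope.

(** * Nested sums and compositions *)

Lemma big_tuple_cons (V : nmodType) (T : finType) (n : nat)
    (P : pred (seq T)) (F : seq T -> V) :
  \sum_(t : n.+1.-tuple T | P t) F t =
  \sum_(x : T) \sum_(t : n.-tuple T | P (x :: t)) F (x :: t).
Proof.
rewrite pair_big_dep /=.
rewrite (reindex (fun q : T * n.-tuple T => cons_tuple q.1 q.2)) //=.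
exists (fun t : n.+1.-tuple T => (thead t, behead_tuple t)).
  by move=> [x t] _ /=; rewrite theadE; congr pair; apply: val_inj.
by move=> t _; apply: val_inj; rewrite /= {3}(tuple_eta t).
Qed.

Lemma big_tuple_rcons (V : nmodType) (T : finType) (n : nat)
    (P : pred (seq T)) (F : seq T -> V) :
  \sum_(t : n.+1.-tuple T | P t) F t =
  \sum_(x : T) \sum_(t : n.-tuple T | P (rcons t x)) F (rcons t x).
Proof.
rewrite pair_big_dep /=.
rewrite (reindex (fun q : T * n.-tuple T => [tuple of rcons q.2 q.1])) //=.
exists (fun t : n.+1.-tuple T =>
          (last (thead t) (behead t), belast_tuple (thead t) (behead_tuple t))).
  move=> [x t] _ /=.
  have E : thead [tuple of rcons t x] :: behead (rcons t x) = rcons t x.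
    by rewrite -[RHS]/(val [tuple of rcons t x]) [in RHS](tuple_eta [tuple of rcons t x]).
  move: (lastI (thead [tuple of rcons t x]) (behead (rcons t x))).
  rewrite E => /rcons_inj[Et Ex]; congr pair; first by rewrite -Ex.
  by apply: val_inj; rewrite /= -Et.
by move=> t _; apply: val_inj; rewrite /= -lastI {3}(tuple_eta t).
Qed.

Lemma big_tuple0 (V : nmodType) (T : finType)
    (P : pred (seq T)) (F : seq T -> V) :
  \sum_(t : 0.-tuple T | P t) F t = if P [::] then F [::] else 0.
Proof.
case: ifPn => P0.
  by rewrite (big_pred1 [tuple]) // => t; rewrite tuple0 /= P0.
by rewrite big_pred0 // => t; rewrite tuple0 /= (negPf P0).
Qed.

(** The index [n.+1] is the largest of the nested indices, so the bound [n] on the remaining ones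
    expresses the strict inequality. *)
Fixpoint nested_sum {R : realType} (s : seq entry) (N : nat) : R :=
  if s is e :: s' then
    \sum_(0 <= n < N) entry_factor R e n.+1 * nested_sum s' n
  else 1.

Lemma big_ord_below (V : nmodType) (N K : nat) (F : nat -> V) :
  (K <= N)%N -> \sum_(i < N | (i < K)%N) F i = \sum_(0 <= i < K) F i.
Proof. by move=> KN; rewrite big_mkord (big_ord_widen N). Qed.

(** Peeling off the head lowers the bound on the tail but not the type of its entries. The separate
    bound [K] lets the induction run inside a fixed ['I_N]. *)
Lemma nested_sum_tuple (R : realType) (s : seq entry) (N K : nat) :
  (K <= N)%N ->
  \sum_(t : (size s).-tuple 'I_N |
        sorted gtn (map val t) && all (fun i => i < K)%N (map val t))
    \prod_(x <- zip s t) entry_factor R x.1 x.2.+1 = nested_sum s K.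
Proof.
elim: s K => [|e s IH] K KN /=.
  rewrite (big_tuple0 _ _ (fun t : seq 'I_N => sorted gtn (map val t) &&
     all (fun i => i < K)%N (map val t))
     (fun t : seq 'I_N => \prod_(x <- zip [::] t) entry_factor R x.1 x.2.+1)) /=.
  by rewrite big_nil.
rewrite (big_tuple_cons _ _ _ (fun t : seq 'I_N => sorted gtn (map val t) &&
     all (fun i => i < K)%N (map val t))
     (fun t : seq 'I_N => \prod_(x <- zip (e :: s) t) entry_factor R x.1 x.2.+1)) /=.
rewrite -(big_ord_below _ N) // [RHS]big_mkcond /=; apply: eq_bigr => x _.
case: ifPn => [xK|xK]; last first.
  by rewrite big1 // => t; rewrite /= andbF.
rewrite -IH; last by rewrite ltnW.
rewrite mulr_sumr; apply: eq_big => [t|t _]; last by rewrite big_cons.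
rewrite (path_sortedE (rev_trans ltn_trans)).
rewrite andbAC -andbA; case: allP => //= h; last by rewrite andbF.
rewrite andbC; congr (_ && _); apply/idP.
by apply/allP => i /h /ltn_trans -> .
Qed.

Lemma mzv_partialE (R : realType) (s : seq entry) (N : nat) :
  mzv_partial R s N = nested_sum s N.
Proof.
rewrite -(@nested_sum_tuple _ _ N) //; apply: eq_bigl => t.
suff -> : all (fun i => i < N)%N (map val t) by rewrite andbT.
by rewrite all_map; apply/allP => i _ /=.
Qed.

(** The inner bound is [n.+1] itself because the inequalities between the indices are weak. *)
Fixpoint star_sum {R : realType} (m N : nat) : R :=
  if m is m'.+1 then \sum_(0 <= n < N) n.+1%:R^-1 * star_sum m' n.+1 else 1.

Lemma star_sum_tuple (R : realType) (m N K : nat) :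
  (K <= N)%N ->
  \sum_(t : m.-tuple 'I_N |
        sorted geq (map val t) && all (fun i => i < K)%N (map val t))
    \prod_(i <- t) i.+1%:R^-1 = star_sum m K :> R.
Proof.
elim: m K => [|m IH] K KN /=.
  rewrite (big_tuple0 _ _ (fun t : seq 'I_N => sorted geq (map val t) &&
     all (fun i => i < K)%N (map val t))
     (fun t : seq 'I_N => \prod_(i <- t) i.+1%:R^-1)) /=.
  by rewrite big_nil.
rewrite (big_tuple_cons _ _ _ (fun t : seq 'I_N => sorted geq (map val t) &&
     all (fun i => i < K)%N (map val t))
     (fun t : seq 'I_N => \prod_(i <- t) i.+1%:R^-1)) /=.
rewrite -(big_ord_below _ N) // [RHS]big_mkcond /=; apply: eq_bigr => x _.
case: ifPn => [xK|xK]; last first.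
  by rewrite big1 // => t; rewrite /= andbF.
rewrite -IH; last exact: ltn_ord.
rewrite mulr_sumr; apply: eq_big => [t|t _]; last by rewrite big_cons.
rewrite (path_sortedE (rev_trans leq_trans)).
rewrite andbAC -andbA; case: allP => //= h; last by rewrite andbF.
rewrite andbC; congr (_ && _); apply/idP.
by apply/allP => i /h /leq_ltn_trans -> .
Qed.

Lemma zeta_star_onesE (R : realType) (n m : nat) :
  zeta_star_ones R n m = star_sum m n.
Proof.
rewrite -(@star_sum_tuple _ _ n) //; apply: eq_bigl => t.
suff -> : all (fun i => i < n)%N (map val t) by rewrite andbT.
by rewrite all_map; apply/allP => i _ /=.
Qed.

(* Sum of F over the lists of p positive integers with total p + d. *)
Fixpoint comp_sum {V : nmodType} (p d : nat) (F : seq nat -> V) : V :=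
  if p is p'.+1 then
    \sum_(0 <= e < d.+1) comp_sum p' e (fun s => F ((d - e).+1 :: s))
  else if d == 0%N then F [::] else 0.

Lemma eq_comp_sum (V : nmodType) (p d : nat) (F G : seq nat -> V) :
  F =1 G -> comp_sum p d F = comp_sum p d G.
Proof.
elim: p d F G => [|p IH] d F G FG /=; first by rewrite FG.
by apply: eq_bigr => e _; apply: IH => s; exact: FG.
Qed.

Lemma comp_sum_sum (V : nmodType) (I : Type) (r : seq I) (p d : nat)
    (F : I -> seq nat -> V) :
  comp_sum p d (fun s => \sum_(i <- r) F i s) = \sum_(i <- r) comp_sum p d (F i).
Proof.
elim: p d F => [|p IH] d F /=; first by case: ifP => // _; rewrite big1.
rewrite exchange_big /=; apply: eq_bigr => e _.
by rewrite (IH _ (fun i s => F i ((d - e).+1 :: s))).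
Qed.

Lemma comp_sumZ (R : pzRingType) (p d : nat) (a : R) (F : seq nat -> R) :
  comp_sum p d (fun s => a * F s) = a * comp_sum p d F.
Proof.
elim: p d F => [|p IH] d F /=; first by case: ifP => // _; rewrite mulr0.
rewrite mulr_sumr; apply: eq_bigr => e _.
by rewrite (IH _ (fun s => F ((d - e).+1 :: s))).
Qed.

Lemma part_sum_ge (b p : nat) (k : p.-tuple 'I_b.+1) :
  all (fun i : 'I_b.+1 => 0 < i)%N k -> (p <= part_sum k)%N.
Proof.
move=> /allP k0; rewrite -[p in (p <= _)%N](size_tuple k) /part_sum -sum1_size.
rewrite big_seq [X in (_ <= X)%N]big_seq; apply: leq_sum => i /k0 //.
Qed.

Lemma big_positive_ord (V : nmodType) (b d : nat) (F : nat -> V) :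
  (d < b)%N ->
  \sum_(x < b.+1 | (0 < x <= d.+1)%N) F x = \sum_(0 <= e < d.+1) F (d - e).+1.
Proof.
move=> db; rewrite big_nat_rev /= add0n.
rewrite (eq_big_nat _ _ (F2 := fun e => F e.+1)); last first.
  by move=> i id; congr F; lia.
rewrite -(big_add1 _ _ 0%N d.+2 xpredT F) [RHS]big_geq_mkord /=.
rewrite (big_ord_widen_cond b.+1 (leq 1) F) //.
Qed.

Lemma sum_composition (V : nmodType) (b p d : nat) (F : seq nat -> V) :
  (p + d <= b)%N ->
  \sum_(k : p.-tuple 'I_b.+1 |
        all (fun i : 'I_b.+1 => 0 < i)%N k && (part_sum k == p + d)%N)
     F (map val k) = comp_sum p d F.
Proof.
elim: p d F => [|p IH] d F pdb /=.
  rewrite (big_tuple0 _ _ (fun k : seq 'I_b.+1 =>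
     all (fun i : 'I_b.+1 => 0 < i)%N k && ((\sum_(i <- k) i)%N == 0 + d)%N)
     (fun k => F (map val k))) /=.
  by rewrite big_nil eq_sym.
rewrite (big_tuple_cons _ _ _ (fun k : seq 'I_b.+1 =>
     all (fun i : 'I_b.+1 => 0 < i)%N k && ((\sum_(i <- k) i)%N == p.+1 + d)%N)
     (fun k => F (map val k))) /=.
pose G x := \sum_(t : p.-tuple 'I_b.+1 |
        all (fun i : 'I_b.+1 => 0 < i)%N t && (part_sum t == p + (d.+1 - x))%N)
     F (x :: map val t).
transitivity (\sum_(x < b.+1 | (0 < x <= d.+1)%N) G x).
  rewrite [RHS]big_mkcond; apply: eq_bigr => x _.
  case: ifPn => xd.
    apply: eq_bigl => t; rewrite big_cons /part_sum.
    by case/andP: xd => -> xd /=; congr (_ && _); lia.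
  rewrite big1 // => t; rewrite big_cons => /andP[/andP[x0 t0]].
  by have := part_sum_ge _ _ _ t0; rewrite /part_sum; lia.
rewrite big_positive_ord; last by lia.
apply: eq_big_nat => e ed; rewrite -IH; last by lia.
by apply: eq_bigl => t; congr (_ && (_ == _)); lia.
Qed.

(** The compositions are grouped by the excess [d] of their total over the least possible total
    [p]. *)
Lemma sum_bounded_composition (V : nmodType) (b p m : nat) (F : seq nat -> V) :
  (p + m <= b)%N ->
  \sum_(k : p.-tuple 'I_b.+1 |
        all (fun i : 'I_b.+1 => 0 < i)%N k && (part_sum k <= p + m)%N)
     F (map val k) = \sum_(0 <= d < m.+1) comp_sum p d F.
Proof.
move=> pmb; under [RHS]eq_big_nat => d dm.
  rewrite -(@sum_composition _ b); last by lia.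
  rewrite big_mkcondr; over.
rewrite /= exchange_big /= big_mkcondr; apply: eq_bigr => k k0.
have pk := part_sum_ge _ _ _ k0.
case: ifPn => km.
  rewrite (bigD1_seq (part_sum k - p)%N) ?iota_uniq//=; last first.
    by rewrite mem_index_iota; lia.
  rewrite subnKC // eqxx big1 ?addr0 // => d; case: ifP => // /eqP ->.
  by rewrite addKn eqxx.
rewrite big_nat big1 // => d dm; case: ifP => // /eqP kd; lia.
Qed.

(** The last entry is split off because in a bar word it is the exponent of the bar, while the
    others are the exponents of the hats. *)
Lemma sum_bounded_composition_rcons (V : nmodType) (b p m : nat)
    (F : seq nat -> V) :
  (p.+1 + m <= b)%N ->
  \sum_(k : p.+1.-tuple 'I_b.+1 |
        all (fun i : 'I_b.+1 => 0 < i)%N k && (part_sum k <= p.+1 + m)%N)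
     F (map val k) =
  \sum_(0 <= e < m.+1) \sum_(0 <= d < e.+1)
     comp_sum p d (fun s => F (rcons s (m - e).+1)).
Proof.
move=> pmb.
rewrite (big_tuple_rcons _ _ _ (fun k : seq 'I_b.+1 =>
     all (fun i : 'I_b.+1 => 0 < i)%N k && ((\sum_(i <- k) i)%N <= p.+1 + m)%N)
     (fun k => F (map val k))) /=.
pose G x := \sum_(t : p.-tuple 'I_b.+1 |
        all (fun i : 'I_b.+1 => 0 < i)%N t && (part_sum t <= p + (m.+1 - x))%N)
     F (rcons (map val t) x).
transitivity (\sum_(x < b.+1 | (0 < x <= m.+1)%N) G x).
  rewrite [RHS]big_mkcond; apply: eq_bigr => x _.
  case: ifPn => xd.
    apply: eq_big => [t|t _]; last by rewrite map_rcons.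
    rewrite -cats1 all_cat big_cat big_seq1 /= /part_sum.
    by case/andP: xd => -> xd /=; rewrite !andbT; congr (_ && _); lia.
  rewrite big1 // => t; rewrite -cats1 all_cat big_cat big_seq1 /=.
  move=> /andP[/and3P[t0 x0 _]].
  by have := part_sum_ge _ _ _ t0; rewrite /part_sum; lia.
rewrite big_positive_ord; last by lia.
apply: eq_big_nat => e em; rewrite -(@sum_bounded_composition _ b); last by lia.
by apply: eq_bigl => t; congr (_ && (_ <= _)%N); lia.
Qed.

(** * Coefficients of the generating functions *)

(* Coefficients of f(x) / (c - x), where f(x) is the power series with coefficients f. *)
Definition div_coef {R : fieldType} (c : R) (f : nat -> R) (m : nat) : R :=
  \sum_(0 <= d < m.+1) f d / c ^+ (m - d).+1.

Lemma div_coef0 (R : fieldType) (c : R) (f : nat -> R) :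
  c != 0 -> c * div_coef c f 0 = f 0%N.
Proof. by move=> c0; rewrite /div_coef big_nat1 expr1 mulrC divfK. Qed.

Lemma div_coefS (R : fieldType) (c : R) (f : nat -> R) (m : nat) :
  c != 0 -> c * div_coef c f m.+1 = f m.+1 + div_coef c f m.
Proof.
move=> c0; rewrite /div_coef big_nat_recr //= subnn expr1 mulrDr addrC.
congr (_ + _); first by rewrite mulrC divfK.
rewrite mulr_sumr; apply: eq_big_nat => d dm.
rewrite subSn; last by lia.
by rewrite [X in _ / X]exprS; field; rewrite c0 expf_neq0.
Qed.

(** The hypotheses are (c - x) g(x) = f(x) read coefficientwise, a recursion that determines g when
    c is nonzero. *)
Lemma div_coef_rec (R : fieldType) (c : R) (f g : nat -> R) :
  c != 0 -> c * g 0%N = f 0%N ->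
  (forall m, c * g m.+1 = f m.+1 + g m) -> g =1 div_coef c f.
Proof.
move=> c0 g0 gS; elim=> [|m IH]; apply: (mulfI c0).
  by rewrite g0 div_coef0.
by rewrite gS div_coefS // IH.
Qed.

(** The coefficients of 1/(c - x)^2 are (j + 1)/c^(j+2). This is the origin of the weights w - 1 -
    |k|_p in the theorem. *)
Lemma div_coef_twice (R : fieldType) (c : R) (f : nat -> R) (m : nat) :
  c != 0 ->
  div_coef c (div_coef c f) m =
  \sum_(0 <= d < m.+1) (m.+1 - d)%:R * (f d / c ^+ (m - d).+2).
Proof.
move=> c0; move: m; apply: fsym; apply: div_coef_rec => // [|m].
  rewrite big_nat1 subn0 mul1r /div_coef big_nat1 /= expr1 expr2 invfM.
  by field.
rewrite big_nat_recr //= mulrDr mulr_sumr.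
rewrite /div_coef [X in _ = X + _]big_nat_recr //= !subnn subSnn mul1r.
rewrite addrAC -big_split /=; congr (_ + _); last by rewrite expr2; field.
apply: eq_big_nat => d dm; rewrite !subSn; [|lia..].
rewrite !exprS -[X in X%:R * _]addn1 natrD; field.
by rewrite c0 expf_neq0.
Qed.

Lemma div_coef_ge0 (R : realFieldType) (c : R) (f : nat -> R) (m : nat) :
  0 <= c -> (forall m, 0 <= f m) -> 0 <= div_coef c f m.
Proof.
by move=> c0 f0; rewrite sumr_ge0 // => d _; rewrite divr_ge0 // exprn_ge0.
Qed.

(* Coefficients in x of e_p(i), the value of which is hat_val x p i below. *)
Fixpoint hat_coef (R : realType) (p i : nat) : nat -> R :=
  if p is p'.+1 then
    fun m => \sum_(0 <= l < i) div_coef l.+1%:R (hat_coef R p' l) m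
  else fun m => (m == 0%N)%:R.
Arguments hat_coef {R}.

Lemma hat_coef_ge0 (R : realType) (p i m : nat) : 0 <= hat_coef p i m :> R.
Proof.
elim: p i m => [|p IH] i m //=.
by rewrite sumr_ge0 // => l _; apply: div_coef_ge0.
Qed.

(** * Removing the decorations: even and odd indices *)

Lemma signr_double (R : pzRingType) (n : nat) : (-1) ^+ n.*2 = 1 :> R.
Proof. by rewrite -mul2n exprM sqrrN !expr1n. Qed.

(** Only even indices 2(l + 1) survive, with factor 2, and the indices below such an index are
    bounded by 2l + 1. *)
Lemma nested_sum_hat (R : realType) (k : nat) (s : seq entry) (i : nat) :
  nested_sum (Hat k.+1 :: s) i.*2 =
  \sum_(0 <= l < i) nested_sum s l.*2.+1 / l.+1%:R ^+ k.+1 / 2 ^+ k :> R.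
Proof.
rewrite /=; elim: i => [|i IH]; first by rewrite !big_geq.
rewrite doubleS [LHS]big_nat_recr //= [X in X + _]big_nat_recr //=.
rewrite [RHS]big_nat_recr //= IH -addrA; congr (_ + _).
rewrite !exprS signr_double.
have -> : i.*2.+2%:R = 2 * i.+1%:R :> R by rewrite -doubleS -muln2 natrM mulrC.
rewrite exprMn; field.
by rewrite !nat1r !expf_neq0 ?pnatr_eq0.
Qed.

Lemma nested_sum_hat_odd (R : realType) (k : nat) (s : seq entry) (i : nat) :
  nested_sum (Hat k :: s) i.*2.+1 = nested_sum (Hat k :: s) i.*2 :> R.
Proof.
rewrite /= big_nat_recr //= exprS signr_double mulr1.
by rewrite subrr !mul0r addr0.
Qed.

(** Only odd indices 2l + 1 = 2(l + 1/2) survive, with factor 2; this is where the half-integers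
    come from. *)
Lemma nested_sum_tilde (R : realType) (k : nat) (s : seq entry) (i : nat) :
  nested_sum (Tilde k.+1 :: s) i.*2 =
  \sum_(0 <= l < i) nested_sum s l.*2 / (l%:R + 2^-1) ^+ k.+1 / 2 ^+ k :> R.
Proof.
rewrite /=; elim: i => [|i IH]; first by rewrite !big_geq.
rewrite doubleS [LHS]big_nat_recr //= [X in X + _]big_nat_recr //=.
rewrite [RHS]big_nat_recr //= IH -addrA; congr (_ + _).
rewrite ![(-1) ^+ _.+1]exprS signr_double mulr1 mulrNN mulr1 subrr !mul0r addr0 opprK.
have -> : i.*2.+1%:R = 2 * (i%:R + 2^-1) :> R.
  by rewrite -addn1 -muln2 natrD natrM; field.
rewrite exprMn (exprS 2 k); field.
rewrite expf_neq0 // ?pnatr_eq0 // expf_neq0 //.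
Qed.

Lemma nested_sum_tilde_odd (R : realType) (k : nat) (s : seq entry) (i : nat) :
  nested_sum (Tilde k :: s) i.+1.*2 = nested_sum (Tilde k :: s) i.*2.+1 :> R.
Proof.
rewrite doubleS /= big_nat_recr //= ![(-1) ^+ _.+1]exprS signr_double mulr1 mulrNN mulr1.
by rewrite subrr !mul0r addr0.
Qed.

(** The indices 2r + 2 and 2r + 3 carry opposite signs and, by the second hypothesis, equal inner
    sums, so they pair up. The index 1 contributes nothing by the first hypothesis. An odd bound
    leaves no pair incomplete. *)
Lemma nested_sum_bar (R : realType) (k : nat) (t : seq entry) (M : nat) :
  nested_sum t 0 = 0 :> R ->
  (forall i, nested_sum t i.+1.*2 = nested_sum t i.*2.+1 :> R) ->
  nested_sum (Bar k.+1 :: t) M.*2.+1 =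
  \sum_(0 <= r < M) ((r.+1%:R ^+ k.+1)^-1 - ((r.+1%:R + 2^-1) ^+ k.+1)^-1) *
     nested_sum t r.+1.*2 / 2 ^+ k.+1 :> R.
Proof.
move=> t0 es; elim: M => [|M IH].
  by rewrite /= big_nat1 /= t0 mulr0 big_geq.
rewrite [LHS]/= -/nested_sum doubleS.
rewrite [LHS]big_nat_recr //= [X in X + _]big_nat_recr //=.
rewrite [RHS]big_nat_recr //= -addrA; congr (_ + _); first exact: IH.
rewrite -doubleS es [(-1) ^+ (M.+1.*2).+1]exprS signr_double mulr1.
have -> : M.+1.*2.+1%:R = 2 * (M.+1%:R + 2^-1) :> R.
  by rewrite -addn1 -muln2 natrD natrM; field.
have -> : M.+1.*2%:R = 2 * M.+1%:R :> R by rewrite -muln2 natrM mulrC.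
rewrite !exprMn !invfM; ring.
Qed.

(** A hat of exponent k contributes 2^(1-k), hence a composition of excess d contributes 2^(-d),
    which the factor [2 ^+ d] cancels. An odd bound only adds an index at which the leading hat
    vanishes. *)
Lemma comp_sum_hat (R : realType) (p d i : nat) :
  comp_sum p d (fun s => 2 ^+ d * nested_sum (map Hat s) i.*2) =
    hat_coef p i d :> R
  /\ comp_sum p d (fun s => 2 ^+ d * nested_sum (map Hat s) i.*2.+1) =
    hat_coef p i d :> R.
Proof.
have E0 : forall N, comp_sum 0 d (fun s => 2 ^+ d * nested_sum (map Hat s) N) =
    hat_coef 0 i d :> R.
  by move=> N; case: d => [|d] //=; rewrite mulr1.
have ES : forall q, comp_sum q.+1 d (fun s => 2 ^+ d * nested_sum (map Hat s) i.*2.+1) =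
   comp_sum q.+1 d (fun s => 2 ^+ d * nested_sum (map Hat s) i.*2) :> R.
  move=> q; apply: eq_big_nat => e _; apply: eq_comp_sum => s.
  by rewrite nested_sum_hat_odd.
suff H : comp_sum p d (fun s => 2 ^+ d * nested_sum (map Hat s) i.*2) =
    hat_coef p i d :> R.
  by split => //; case: p H => [|p] H; [exact: E0|rewrite ES].
elim: p d i {E0 ES} => [|p IH] d i; first by case: d => [|d] //=; rewrite mulr1.
have H e l : comp_sum p e (fun s => 2 ^+ e * nested_sum (map Hat s) l.*2.+1) =
    hat_coef p l e :> R.
  case: p IH => [|p] IH; first by case: e => [|e] //=; rewrite mulr1.
  rewrite -IH; apply: eq_big_nat => k _; apply: eq_comp_sum => s.
  by rewrite nested_sum_hat_odd.
rewrite [LHS]/= [RHS]/= /div_coef exchange_big /=; apply: eq_big_nat => e ed.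
under eq_comp_sum => s do rewrite -/(nested_sum (Hat (d - e).+1 :: _) _) nested_sum_hat mulr_sumr.
rewrite comp_sum_sum; apply: eq_bigr => l _.
rewrite -H mulrC -comp_sumZ; apply: eq_comp_sum => s.
have -> : 2 ^+ d = 2 ^+ (d - e) * 2 ^+ e :> R by rewrite -exprD; congr (_ ^+ _); lia.
field.
by rewrite ?nat1r !expf_neq0 ?pnatr_eq0.
Qed.

Lemma eq_in_comp_sum (V : nmodType) (p d : nat) (F G : seq nat -> V) :
  (forall s, size s = p -> sumn s = (p + d)%N -> F s = G s) ->
  comp_sum p d F = comp_sum p d G.
Proof.
elim: p d F G => [|p IH] d F G FG /=.
  by case: eqP => // d0; apply: FG; rewrite //= d0.
apply: eq_big_nat => e ed; apply: IH => s sp se; apply: FG => /=.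
  by rewrite sp.
by rewrite se; lia.
Qed.

Lemma part_sumE (b p : nat) (k : p.-tuple 'I_b.+1) :
  part_sum k = sumn (map val k).
Proof. by rewrite /part_sum sumnE big_map. Qed.

Definition half_shift {R : realType} (i : nat) : R := i%:R + 2^-1.

(* Contributions to the coefficients of T and B in the introduction. *)
Definition tilde_coef {R : realType} (p i : nat) : nat -> R :=
  div_coef (half_shift i) (div_coef (half_shift i) (hat_coef p i)).

Definition bar_coef {R : realType} (p r m : nat) : R :=
  \sum_(0 <= i < r.+1)
    (div_coef r.+1%:R (div_coef (half_shift i) (hat_coef p i)) m -
     div_coef (half_shift r.+1) (div_coef (half_shift i) (hat_coef p i)) m).

Lemma half_shift_gt0 (R : realType) (i : nat) : 0 < half_shift i :> R.
Proof. by rewrite ltr_wpDl. Qed.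

Lemma half_shift_neq0 (R : realType) (i : nat) : half_shift i != 0 :> R.
Proof. by rewrite gt_eqF // half_shift_gt0. Qed.

(** The tilde has exponent m - d + 2 and contributes 2^(-(m-d+1)), the hats contribute 2^(-d);
    together they absorb the factor [2 ^+ (m + 1)]. *)
Lemma sum_tilde_word (R : realType) (w b p m N : nat) :
  w = (m + p + 2)%N -> b = (w - 2)%N ->
  2 ^+ (m + 1) * \sum_(k : p.-tuple 'I_b.+1 | bounded_composition k)
      (w - 1 - part_sum k)%:R * nested_sum (tilde_word w k) N.*2 =
  \sum_(0 <= i < N) tilde_coef p i m :> R.
Proof.
move=> wE bE.
pose F s : R := (w - 1 - sumn s)%:R *
  nested_sum (Tilde (w - sumn s) :: map Hat s) N.*2.
transitivity (2 ^+ (m + 1) * \sum_(k : p.-tuple 'I_b.+1 |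
   all (fun i : 'I_b.+1 => 0 < i)%N k && (part_sum k <= p + m)%N) F (map val k)).
  congr (_ * _); apply: eq_big => [k|k _].
    by rewrite /bounded_composition; congr (_ && (_ <= _)%N); lia.
  by rewrite /F -part_sumE /tilde_word -map_comp.
rewrite sum_bounded_composition; last by lia.
rewrite mulr_sumr.
transitivity (\sum_(0 <= d < m.+1) \sum_(0 <= i < N)
   ((m.+1 - d)%:R * (hat_coef p i d / half_shift i ^+ (m - d).+2) : R)).
  apply: eq_big_nat => d dm; rewrite -comp_sumZ.
  rewrite (eq_in_comp_sum _ _ _ _ (fun s => \sum_(0 <= i < N)
     ((m.+1 - d)%:R / half_shift i ^+ (m - d).+2) *
      (2 ^+ d * nested_sum (map Hat s) i.*2))); last first.
    move=> s _ sE; rewrite /F sE.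
    have -> : (w - (p + d) = (m - d).+2)%N by lia.
    have -> : (w - 1 - (p + d) = m.+1 - d)%N by lia.
    rewrite nested_sum_tilde !mulr_sumr; apply: eq_bigr => i _.
    rewrite -/(half_shift i).
    have -> : 2 ^+ (m + 1) = 2 ^+ (m - d).+1 * 2 ^+ d :> R.
      by rewrite -exprD; congr (_ ^+ _); lia.
    by field; rewrite !expf_neq0 ?pnatr_eq0 ?half_shift_neq0.
  rewrite comp_sum_sum; apply: eq_bigr => i _.
  rewrite comp_sumZ (comp_sum_hat _ _ _ _).1; ring.
rewrite exchange_big /=; apply: eq_bigr => i _.
by rewrite /tilde_coef div_coef_twice // half_shift_neq0.
Qed.

(** With bar exponent m - e + 1, tilde exponent e - d + 1 and hats of excess d, the powers of 2 are
    2^(-(m-e+1)), 2^(-(e-d)) and 2^(-d), again with product 2^(-(m+1)). *)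
Lemma sum_bar_word (R : realType) (w b p m M : nat) :
  w = (m + p + 2)%N -> b = (w - 1)%N ->
  2 ^+ (m + 1) * \sum_(k : p.+1.-tuple 'I_b.+1 | bounded_composition k)
      nested_sum (bar_word w k) M.*2.+1 =
  \sum_(0 <= r < M) bar_coef p r m :> R.
Proof.
move=> wE bE.
pose F s : R := nested_sum [:: Bar (last 0%N s), Tilde (w - sumn s) &
  map Hat (take p s)] M.*2.+1.
transitivity (2 ^+ (m + 1) * \sum_(k : p.+1.-tuple 'I_b.+1 |
   all (fun i : 'I_b.+1 => 0 < i)%N k && (part_sum k <= p.+1 + m)%N) F (map val k)).
  congr (_ * _); apply: eq_big => [k|k _].
    by rewrite /bounded_composition; congr (_ && (_ <= _)%N); lia.
  rewrite /F -part_sumE /bar_word; congr (nested_sum [:: Bar _, _ & _] _).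
    rewrite -nth_last size_map size_tuple /= -(tnth_nth 0%N (map_tuple val k) ord_max).
    by rewrite tnth_map.
  by rewrite -map_take -map_comp.
rewrite sum_bounded_composition_rcons; last by lia.
rewrite mulr_sumr.
pose G r i e : R := (r.+1%:R ^- (m - e).+1 - half_shift r.+1 ^- (m - e).+1) *
   div_coef (half_shift i) (hat_coef p i) e.
transitivity (\sum_(0 <= e < m.+1) \sum_(0 <= r < M) \sum_(0 <= i < r.+1) G r i e).
  apply: eq_big_nat => e em; rewrite mulr_sumr.
  transitivity (\sum_(0 <= d < e.+1) \sum_(0 <= r < M) \sum_(0 <= i < r.+1)
     ((r.+1%:R ^- (m - e).+1 - half_shift r.+1 ^- (m - e).+1) *
       (hat_coef p i d / half_shift i ^+ (e - d).+1) : R)).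
    apply: eq_big_nat => d de; rewrite -comp_sumZ.
    rewrite (eq_in_comp_sum _ _ _ _ (fun s => \sum_(0 <= r < M) \sum_(0 <= i < r.+1)
       ((r.+1%:R ^- (m - e).+1 - half_shift r.+1 ^- (m - e).+1) /
          half_shift i ^+ (e - d).+1) *
        (2 ^+ d * nested_sum (map Hat s) i.*2))); last first.
      move=> s sp sE; rewrite /F last_rcons sumn_rcons sE -cats1 take_size_cat //.
      rewrite (_ : (w - (p + d + (m - e).+1) = (e - d).+1)%N); last by lia.
      rewrite nested_sum_bar; first last.
      - by move=> i; rewrite nested_sum_tilde_odd.
      - by rewrite /= big_geq.
      rewrite mulr_sumr; apply: eq_bigr => r _.
      rewrite nested_sum_tilde !mulr_sumr !mulr_suml mulr_sumr; apply: eq_bigr => i _.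
      rewrite -/(half_shift i) -/(half_shift r.+1).
      have -> : 2 ^+ (m + 1) = 2 ^+ (m - e).+1 * 2 ^+ (e - d) * 2 ^+ d :> R.
        by rewrite -!exprD; congr (_ ^+ _); lia.
      field.
      by rewrite !expf_neq0 ?pnatr_eq0 ?half_shift_neq0.
    rewrite comp_sum_sum; apply: eq_bigr => r _.
    rewrite comp_sum_sum; apply: eq_bigr => i _.
    rewrite comp_sumZ (comp_sum_hat _ _ _ _).1; ring.
  rewrite exchange_big /=; apply: eq_bigr => r _.
  rewrite exchange_big /=; apply: eq_bigr => i _.
  by rewrite /G /div_coef mulr_sumr.
rewrite exchange_big /=; apply: eq_bigr => r _.
rewrite exchange_big /=; apply: eq_bigr => i _.
rewrite [in RHS]/div_coef -sumrB; apply: eq_bigr => e _.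
by rewrite /G mulrC mulrBr.
Qed.

(** * The identity at a fixed x *)

Lemma nneseries_telescope (R : realType) (u : nat -> R) :
  u @ \oo --> (0 : R) ->
  (\sum_(k <oo) (u k - u k.+1)%:E = (u 0%N)%:E)%E.
Proof.
move=> u0; apply: cvg_lim => //.
have -> : (fun n => \sum_(0 <= k < n) (u k - u k.+1)%:E)%E =
    (fun n => (u 0%N - u n)%:E).
  apply/funext => n; rewrite sumEFin; congr EFin.
  by rewrite -[LHS]opprK -sumrN (eq_bigr _ (fun k _ => opprB _ _)) telescope_sumr // opprB.
apply: cvg_EFin; first by near=> n.
rewrite -[X in _ --> X]subr0; apply: cvgB => //; exact: cvg_cst.
Unshelve. all: by end_near. Qed.

Lemma nneseries_ord (R : realType) (f : nat -> \bar R) (n : nat) :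
  (\sum_(k <oo) (if (k < n)%N then f k else 0) = \sum_(0 <= k < n) f k)%E.
Proof.
apply: lim_near_cst => //; exists n => // N /= nN.
rewrite (big_cat_nat (leq0n n) nN) //= [X in (_ + X)%E]big_nat [X in (_ + X)%E]big1 ?adde0.
  by apply: eq_big_nat => k /andP[_ ->].
by move=> k /andP[nk _]; rewrite ltnNge nk.
Qed.

(** Tonelli, after the inner sum has been extended by zeros to all [l]; on the right [j] stands for
    i - l. *)
Lemma nneseries_triangle (R : realType) (f : nat -> nat -> \bar R) :
  (forall l i, (0 <= f l i)%E) ->
  (\sum_(i <oo) \sum_(0 <= l < i.+1) f l i =
   \sum_(l <oo) \sum_(j <oo) f l (j + l)%N)%E.
Proof.
move=> f0; transitivity (\sum_(i <oo) \sum_(l <oo) (if (l < i.+1)%N then f l i else 0))%E.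
  by apply: eq_eseriesr => i _; rewrite nneseries_ord.
rewrite nneseries_interchange; last by move=> i j; case: ifP.
apply: eq_eseriesr => l _.
rewrite (nneseries_split 0%N l); last by move=> k _; case: ifP.
rewrite add0n [X in (X + _)%E]big_nat [X in (X + _)%E]big1 ?add0e; last first.
  by move=> i /andP[_ il]; rewrite ltnS leqNgt il.
rewrite (nneseries_addn (f := f l)) //.
rewrite -!(@nneseries_addn _ _ l) //; last by move=> k; case: ifP.
by apply: eq_eseriesr => i _; rewrite ltnS leq_addl.
Qed.

Lemma nneseries_strict_triangle (R : realType) (f : nat -> nat -> \bar R) :
  (forall l i, (0 <= f l i)%E) ->
  (\sum_(i <oo) \sum_(0 <= l < i) f l i =
   \sum_(l <oo) \sum_(j <oo) f l (j + l).+1)%E.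
Proof.
move=> f0; rewrite nneseries_recl //; last by move=> k _; exact: sume_ge0.
rewrite big_geq // add0e -(@nneseries_addn _ _ 1); last first.
  by move=> k; exact: sume_ge0.
transitivity (\sum_(i <oo) \sum_(0 <= l < i.+1) f l i.+1)%E.
  by apply: eq_eseriesr => i _; rewrite addn1.
by rewrite (nneseries_triangle _ (fun l i => f l i.+1)).
Qed.

(** * Rising factorials and their telescoping series *)

Definition poch {R : realType} (a : R) (n : nat) : R :=
  \prod_(0 <= j < n) (a + j%:R).

Lemma poch0 (R : realType) (a : R) : poch a 0 = 1.
Proof. by rewrite /poch big_geq. Qed.

Lemma pochS (R : realType) (a : R) (n : nat) : poch a n.+1 = poch a n * (a + n%:R).
Proof. by rewrite /poch big_nat_recr. Qed.

Lemma pochD (R : realType) (a : R) (m n : nat) :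
  poch a (m + n) = poch a m * poch (a + m%:R) n.
Proof.
elim: n => [|n IH]; first by rewrite addn0 poch0 mulr1.
by rewrite addnS !pochS IH natrD -!mulrA addrA.
Qed.

Lemma pochSl (R : realType) (a : R) (n : nat) : poch a n.+1 = a * poch (a + 1) n.
Proof. by rewrite -add1n pochD pochS poch0 mul1r addr0. Qed.

Lemma poch_gt0 (R : realType) (a : R) (n : nat) : 0 < a -> 0 < poch a n.
Proof. by move=> a0; rewrite prodr_gt0 // => i _; rewrite ltr_pwDl. Qed.

Lemma poch_ratioB (R : realType) (a c : R) (k : nat) : 0 < c ->
  poch a k / poch c k - poch a k.+1 / poch c k.+1 =
  (c - a) * (poch a k / poch c k.+1).
Proof.
move=> c0; rewrite !pochS; field.
by rewrite !gt_eqF ?poch_gt0 // ltr_pwDl.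
Qed.

Lemma poch_ratio_cvg0 (R : realType) (a c : R) : 0 < a -> a < c ->
  (fun k => poch a k / poch c k) @ \oo --> (0 : R).
Proof.
move=> a0 ac; have c0 : 0 < c by exact: lt_trans ac.
set u := fun k => _.
have u0 k : 0 <= u k by rewrite divr_ge0 // ltW // poch_gt0.
have uS k : u k - u k.+1 = (c - a) * (u k / (c + k%:R)).
  rewrite /u poch_ratioB // pochS; field.
  by rewrite !gt_eqF ?poch_gt0 // ltr_pwDl.
have udec : nonincreasing_seq u.
  apply/nonincreasing_seqP => k; rewrite -subr_ge0 uS.
  apply: mulr_ge0; first by rewrite subr_ge0 ltW.
  by apply: divr_ge0 => //; rewrite addr_ge0 // ltW.
have ucvg : cvgn u.
  by apply: nonincreasing_is_cvgn => //; exists 0 => _ [k _ <-].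
have lu k : limn u <= u k by exact: nonincreasing_cvgn_ge.
suff -> : 0 = limn u by [].
apply/eqP; rewrite eq_le limr_ge //=; last by near=> k.
rewrite leNgt; apply/negP => l0.
(* A positive limit would bound a multiple of the harmonic series. *)
apply: (@dvg_harmonic R).
(* [K] dominates both c and 1, so that c + k <= K (k + 1). Then [C] is the constant for which 1/(k +
   1) <= C (u k - u k.+1), because u k is at least its limit. *)
pose K := Num.max c 1.
have K1 : 1 <= K by rewrite le_max lexx orbT.
have cK : c <= K by rewrite le_max lexx.
have K0 : 0 < K by exact: lt_le_trans K1.
pose C := K / (limn u * (c - a)).
have C0 : 0 < C by rewrite divr_gt0 // mulr_gt0 // subr_gt0.
apply: nondecreasing_is_cvgn.
  by apply/nondecreasing_seqP => n; rewrite /series /= big_nat_recr //= lerDl invr_ge0.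
exists (C * u 0%N) => _ [n _ <-].
apply: (@le_trans _ _ (C * (u 0%N - u n))); last first.
  by rewrite ler_pM2l // gerBl.
have -> : u 0%N - u n = \sum_(0 <= k < n) (u k - u k.+1).
  by rewrite -[RHS]opprK -sumrN (eq_bigr _ (fun k _ => opprB _ _)) telescope_sumr // opprB.
rewrite mulr_sumr /series /=; apply: ler_sum_nat => k _.
rewrite uS /harmonic /C.
have ck : 0 < c + k%:R by rewrite ltr_pwDl.
have -> : K / (limn u * (c - a)) * ((c - a) * (u k / (c + k%:R))) =
   (K / (c + k%:R)) * (u k / limn u).
  by field; rewrite !gt_eqF // subr_gt0.
apply: (@le_trans _ _ (K / (c + k%:R))); last first.
  by rewrite ler_peMr ?divr_ge0 // ?(ltW ck) ?(ltW K0) // ler_pdivlMr // mul1r.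
rewrite ler_pdivlMr // mulrC ler_pdivrMr // -addn1 natrD mulrDr mulr1.
by rewrite addrC lerD // ler_peMl.
Unshelve. all: by end_near. Qed.

Lemma nneseries_poch (R : realType) (a c : R) : 0 < a -> a < c ->
  (\sum_(k <oo) (poch a k / poch c k.+1)%:E = (c - a)^-1%:E)%E.
Proof.
move=> a0 ac; have c0 : 0 < c by exact: lt_trans ac.
have ca : c - a != 0 by rewrite subr_eq0 gt_eqF.
have := nneseries_telescope _ (fun k => (c - a)^-1 * (poch a k / poch c k)).
rewrite !poch0 divr1 mulr1 => <-; last first.
  rewrite -[X in _ --> X](mulr0 (c - a)^-1).
  by apply: cvgM; [exact: cvg_cst|exact: poch_ratio_cvg0].
apply: eq_eseriesr => k _; congr EFin.
by rewrite -mulrBr poch_ratioB // mulKf.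
Qed.

(** Splitting (b)_(i+N+2) after i factors and after N + 1 factors turns the summand into (b)_i /
    (b+N+1)_(i+1), up to a constant. The series of [nneseries_poch] with a = b and c = b + N + 1
    then applies. *)
Lemma nneseries_inv_poch (R : realType) (b : R) (N : nat) : 0 < b ->
  (\sum_(i <oo) (poch (b + i%:R) N.+2)^-1%:E =
   (N.+1%:R * poch b N.+1)^-1%:E)%E.
Proof.
move=> b0; have bi i : 0 < b + i%:R by rewrite ltr_pwDl.
have E i : (poch (b + i%:R) N.+2)^-1 =
    (poch b N.+1)^-1 * (poch b i / poch (b + N.+1%:R) i.+1).
  have := pochD _ b i N.+2; rewrite (_ : i + N.+2 = N.+1 + i.+1)%N; last by lia.
  rewrite pochD => H; apply: (mulIf (x := poch b N.+1 * poch (b + N.+1%:R) i.+1)).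
    by rewrite mulf_neq0 // gt_eqF // poch_gt0.
  rewrite [in LHS]H; field.
  by rewrite !gt_eqF // poch_gt0.
under eq_eseriesr do rewrite E EFinM.
rewrite nneseriesZl; last first.
  by move=> i _; rewrite lee_fin divr_ge0 // ltW // poch_gt0.
rewrite nneseries_poch // ?ltrDl // -EFinM addrAC subrr add0r.
by rewrite invfM mulrC.
Qed.

Fixpoint hat_val {R : realType} (x : R) (p i : nat) : R :=
  if p is p'.+1 then
    \sum_(0 <= l < i) hat_val x p' l / (l.+1%:R - x)
  else 1.

Section real_identity.
Variables (R : realType) (x : R).
Hypotheses (x0 : 0 <= x) (x12 : x < 2^-1).

Let x1 : x < 1. Proof. by move: x12; lra. Qed.

Let natx_gt0 l : 0 < l.+1%:R - x.
Proof. by rewrite -natr1; have := ler0n R l; move: x0 x12; lra. Qed.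

Let half_gt0 i : 0 < half_shift i - x.
Proof. by rewrite /half_shift; have := ler0n R i; move: x0 x12; lra. Qed.

Lemma hat_val_ge0 p i : 0 <= hat_val x p i.
Proof.
elim: p i => [|p IH] i //=.
by rewrite sumr_ge0 // => l _; rewrite divr_ge0 // ltW.
Qed.

(** In the induction step the sum over i > l gives 1/((N+1) (l+2-x)_(N+1)). The factor 1/(l+1-x)
    coming from e_(p+1) completes this to 1/((N+1) (l+1-x)_(N+2)), so the case p reappears with an
    extra 1/(N+1). *)
Lemma nneseries_hat_val p N :
  (\sum_(i <oo) (hat_val x p i / poch (i.+1%:R - x) N.+2)%:E =
   (poch (1 - x) N.+1 * N.+1%:R ^+ p.+1)^-1%:E)%E.
Proof.
elim: p => [|p IH].
  have := nneseries_inv_poch R (1 - x) N; rewrite subr_gt0 => /(_ x1).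
  rewrite expr1 mulrC => <-; apply: eq_eseriesr => i _ /=.
  by rewrite mul1r -nat1r addrAC.
transitivity (\sum_(i <oo) \sum_(0 <= l < i)
   (hat_val x p l / (l.+1%:R - x) / poch (i.+1%:R - x) N.+2)%:E)%E.
  by apply: eq_eseriesr => i _; rewrite sumEFin /= mulr_suml.
rewrite (nneseries_strict_triangle _ (fun l i =>
  (hat_val x p l / (l.+1%:R - x) / poch (i.+1%:R - x) N.+2)%:E)); last first.
  move=> l i; rewrite lee_fin !divr_ge0 ?hat_val_ge0 //; apply: ltW => //.
  exact: poch_gt0.
transitivity (\sum_(l <oo)
  (N.+1%:R^-1%:E * (hat_val x p l / poch (l.+1%:R - x) N.+2)%:E))%E.
  apply: eq_eseriesr => l _; under eq_eseriesr do rewrite EFinM.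
  rewrite nneseriesZl; last first.
    by move=> i _; rewrite lee_fin invr_ge0 ltW // poch_gt0.
  have := nneseries_inv_poch R (l.+2%:R - x) N => /(_ (natx_gt0 _)) H.
  transitivity ((hat_val x p l / (l.+1%:R - x))%:E *
      (\sum_(i <oo) (poch (l.+2%:R - x + i%:R) N.+2)^-1%:E))%E.
    congr (_ * _)%E; apply: eq_eseriesr => i _; congr ((poch _ _)^-1)%:E.
    by rewrite -!addnS natrD; ring.
  rewrite H -!EFinM (pochSl _ _ N.+1); congr EFin.
  rewrite (_ : l.+1%:R - x + 1 = l.+2%:R - x); last by rewrite -!natr1; ring.
  have p0 : poch (l.+2%:R - x) N.+1 != 0 by rewrite gt_eqF // poch_gt0.
  have lx : l.+1%:R - x != 0 by rewrite gt_eqF.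
  by field; rewrite p0 !nat1r lx pnatr_eq0.
rewrite nneseriesZl; last first.
  by move=> i _; rewrite lee_fin divr_ge0 ?hat_val_ge0 ?ltW ?poch_gt0.
rewrite IH -EFinM -invfM; congr (_^-1)%:E.
by rewrite [in RHS]exprS; ring.
Qed.

(** With c = i + r + 1 - x, the first fraction is 1/(c - 1/2), expanded by [nneseries_poch] with a =
    1/2. Its initial term is 1/c, exactly the fraction subtracted. The rest is summed over r by
    [nneseries_inv_poch]. *)
Lemma nneseries_half_diff i :
  (\sum_(r <oo) ((half_shift (i + r) - x)^-1 - ((i + r).+1%:R - x)^-1)%:E =
   \sum_(k <oo) (poch 2^-1 k.+1 / (k.+1%:R * poch (i.+1%:R - x) k.+1))%:E)%E.
Proof.
have h0 : (0 : R) < 2^-1 by rewrite invr_gt0.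
transitivity (\sum_(r <oo) \sum_(k <oo)
   (poch 2^-1 k.+1 / poch (i.+1%:R - x + r%:R) k.+2)%:E)%E.
  apply: eq_eseriesr => r _.
  set c := i.+1%:R - x + r%:R.
  have cE : c = (i + r).+1%:R - x by rewrite /c -addSn natrD; ring.
  have c12 : 2^-1 < c.
    rewrite cE -[(i + r).+1%:R]natr1.
    by have := ler0n R (i + r); move: x0 x12; lra.
  have c0 : 0 < c by lra.
  have t0 k : 0 <= poch 2^-1 k / poch c k.+1 by rewrite divr_ge0 // ltW // poch_gt0.
  have := nneseries_poch R 2^-1 c h0 c12.
  rewrite nneseries_recl; [|by move=> k _; rewrite lee_fin|by []].
  rewrite -(@nneseries_addn _ _ 1) //.
  have -> : (\sum_(k <oo) (poch 2^-1 (k + 1) / poch c (k + 1).+1)%:E =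
             \sum_(k <oo) (poch 2^-1 k.+1 / poch c k.+2)%:E)%E.
    by apply: eq_eseriesr => k _; rewrite addn1.
  rewrite poch0 div1r pochS poch0 mul1r addr0 -cE.
  have -> : half_shift (i + r) - x = c - 2^-1.
    by rewrite cE /half_shift -[(i + r).+1%:R]natr1; field.
  move=> H; by rewrite EFinB -H addeAC subee // add0e.
rewrite nneseries_interchange; last first.
  move=> r k; rewrite lee_fin divr_ge0 // ltW // poch_gt0 //.
  by rewrite ltr_wpDr.
apply: eq_eseriesr => k _.
under eq_eseriesr do rewrite EFinM.
rewrite nneseriesZl; last first.
  by move=> r _; rewrite lee_fin invr_ge0 ltW // poch_gt0 // ltr_wpDr.
by rewrite nneseries_inv_poch // -EFinM.
Qed.

(** For each k, the factor 1/(i + 1/2 - x) is expanded with both parameters shifted by k + 1. The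
    shift leaves c - a unchanged, and the rising factorials now concatenate to length k + 1 + q. For
    N = k + q only the coefficient 1/(k + 1) still depends on k, and summing it over k <= N produces
    the harmonic number. *)
Lemma nneseries_half_diff_div i :
  (((half_shift i - x)^-1)%:E *
   \sum_(r <oo) ((half_shift (i + r) - x)^-1 - ((i + r).+1%:R - x)^-1)%:E =
   \sum_(N <oo) (harmonic_number R N.+1 * poch 2^-1 N.+1 /
      poch (i.+1%:R - x) N.+2)%:E)%E.
Proof.
have h0 : (0 : R) < 2^-1 by rewrite invr_gt0.
rewrite nneseries_half_diff -nneseriesZl; last first.
  by move=> k _; rewrite lee_fin divr_ge0 ?mulr_ge0 // ltW // poch_gt0.
have hs k : 0 <= poch 2^-1 k.+1 / poch (i.+1%:R - x) k.+2.
  by rewrite divr_ge0 // ltW // poch_gt0.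
transitivity (\sum_(k <oo) \sum_(q <oo)
   ((k.+1%:R)^-1 * (poch 2^-1 (q + k).+1 / poch (i.+1%:R - x) (q + k).+2))%:E)%E.
  apply: eq_eseriesr => k _.
  set a := 2^-1 + k.+1%:R : R; set c := i.+1%:R - x + k.+1%:R.
  have a0 : 0 < a by rewrite ltr_wpDr.
  have ac : a < c by rewrite ltrD2r -[i.+1%:R]natr1; have := ler0n R i; move: x0 x12; lra.
  have c0 : 0 < c by exact: lt_trans ac.
  have := nneseries_poch R a c a0 ac.
  have -> : c - a = half_shift i - x by rewrite /c /a /half_shift -[i.+1%:R]natr1; field.
  move=> <-; rewrite muleC -nneseriesZl; last first.
    by move=> q _; rewrite lee_fin divr_ge0 // ltW // poch_gt0.
  apply: eq_eseriesr => q _; rewrite -EFinM; congr EFin.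
  rewrite (_ : (q + k).+1 = k.+1 + q)%N; last by lia.
  rewrite -addnS.
  rewrite !pochD -/a -/c; field.
  by rewrite nat1r pnatr_eq0 !gt_eqF // poch_gt0.
rewrite -(nneseries_triangle _ (fun k N =>
   ((k.+1%:R)^-1 * (poch 2^-1 N.+1 / poch (i.+1%:R - x) N.+2))%:E)); last first.
  by move=> l k; rewrite lee_fin mulr_ge0.
apply: eq_eseriesr => N _; rewrite sumEFin -mulr_suml mulrA; congr (_ * _ * _)%:E.
by rewrite /harmonic_number [RHS]big_add1.
Qed.

Lemma nneseries_binomial_value p :
  (\sum_(i <oo) ((hat_val x p i / (half_shift i - x))%:E *
   \sum_(r <oo) ((half_shift (i + r) - x)^-1 - ((i + r).+1%:R - x)^-1)%:E) =
   \sum_(N <oo) (harmonic_number R N.+1 * poch 2^-1 N.+1 /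
      (poch (1 - x) N.+1 * N.+1%:R ^+ p.+1))%:E)%E.
Proof.
have h0 : (0 : R) < 2^-1 by rewrite invr_gt0.
have H0 N : 0 <= harmonic_number R N by rewrite sumr_ge0.
have hs i N : 0 <= harmonic_number R N.+1 * poch 2^-1 N.+1 / poch (i.+1%:R - x) N.+2.
  by rewrite divr_ge0 ?mulr_ge0 // ltW // poch_gt0.
transitivity (\sum_(i <oo) \sum_(N <oo) (hat_val x p i *
   (harmonic_number R N.+1 * poch 2^-1 N.+1 / poch (i.+1%:R - x) N.+2))%:E)%E.
  apply: eq_eseriesr => i _; rewrite EFinM -muleA nneseries_half_diff_div.
  by rewrite -nneseriesZl // => N _; rewrite lee_fin.
rewrite nneseries_interchange; last first.
  by move=> i N; rewrite lee_fin mulr_ge0 // hat_val_ge0.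
apply: eq_eseriesr => N _.
rewrite EFinM -nneseries_hat_val -nneseriesZl; last first.
  by move=> i _; rewrite lee_fin divr_ge0 ?hat_val_ge0 // ltW // poch_gt0.
by apply: eq_eseriesr => i _; rewrite -EFinM; congr EFin; ring.
Qed.

(** 1/(z + r) equals (1/z) (z)_r / (z+1)_r, an instance of the ratio in [poch_ratio_cvg0]. *)
Lemma cvg_inv_shift (k : nat) :
  (fun r => (half_shift (k + r) - x)^-1) @ \oo --> (0 : R).
Proof.
have -> : (fun r => (half_shift (k + r) - x)^-1) =
    (fun r => (half_shift k - x) ^-1 * (poch (half_shift k - x) r /
                 poch (half_shift k - x + 1) r)).
  apply/funext => r; set z := half_shift k - x.
  have z0 : 0 < z by exact: half_gt0.
  have := pochS _ z r; rewrite pochSl => H.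
  have -> : half_shift (k + r) - x = z + r%:R by rewrite /z /half_shift natrD; ring.
  have z1 : 0 < poch (z + 1) r by rewrite poch_gt0 // addr_gt0.
  have zr : 0 < z + r%:R by rewrite ltr_pwDl.
  have -> : poch z r = z * poch (z + 1) r / (z + r%:R) by rewrite H mulfK // gt_eqF.
  by field; rewrite !gt_eqF.
rewrite -[X in _ --> X](mulr0 (half_shift k - x)^-1).
apply: cvgM; first exact: cvg_cst.
by apply: poch_ratio_cvg0; rewrite // ltrDl.
Qed.

(** The differences interlace between half-integers and integers and telescope. Multiplied by
    e_p(i)/(i + 1/2 - x) and summed over i, the two series on the left yield L and B, and the right
    side yields T. *)
Lemma nneseries_unit_diff i :
  (\sum_(r <oo) ((half_shift (i + r) - x)^-1 - ((i + r).+1%:R - x)^-1)%:E +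
   \sum_(r <oo) (((i + r).+1%:R - x)^-1 - (half_shift (i + r).+1 - x)^-1)%:E =
   ((half_shift i - x)^-1)%:E)%E.
Proof.
rewrite -nneseriesD; last 2 first.
- move=> r _ _; rewrite lee_fin subr_ge0 lef_pV2 ?posrE // /half_shift -[(i + r).+1%:R]natr1; lra.
- move=> r _ _; rewrite lee_fin subr_ge0 lef_pV2 ?posrE // /half_shift; lra.
transitivity (\sum_(r <oo) ((half_shift (i + r) - x)^-1 - (half_shift (i + r.+1) - x)^-1)%:E)%E.
  by apply: eq_eseriesr => r _; rewrite -EFinD addrA subrK addnS.
rewrite (nneseries_telescope _ (fun r => (half_shift (i + r) - x)^-1)) ?addn0 //.
exact: cvg_inv_shift.
Qed.

Lemma nneseries_real_identity p :
  (\sum_(N <oo) (harmonic_number R N.+1 * poch 2^-1 N.+1 /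
      (poch (1 - x) N.+1 * N.+1%:R ^+ p.+1))%:E +
   \sum_(r <oo) (((r.+1%:R - x)^-1 - (half_shift r.+1 - x)^-1) *
      \sum_(0 <= i < r.+1) hat_val x p i / (half_shift i - x))%:E =
   \sum_(i <oo) (hat_val x p i / (half_shift i - x) ^+ 2)%:E)%E.
Proof.
have d0 r : 0 <= (r.+1%:R - x)^-1 - (half_shift r.+1 - x)^-1.
  by rewrite subr_ge0 lef_pV2 ?posrE // /half_shift; lra.
have e0 r : 0 <= (half_shift r - x)^-1 - (r.+1%:R - x)^-1.
  by rewrite subr_ge0 lef_pV2 ?posrE // /half_shift -[r.+1%:R]natr1; lra.
have hz i : 0 <= hat_val x p i / (half_shift i - x).
  by rewrite divr_ge0 ?hat_val_ge0 // ltW.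
(* B is rewritten with the outer sum over i, to match the form of L in
   [nneseries_binomial_value]. *)
have -> : (\sum_(r <oo) (((r.+1%:R - x)^-1 - (half_shift r.+1 - x)^-1) *
      \sum_(0 <= i < r.+1) hat_val x p i / (half_shift i - x))%:E =
   \sum_(i <oo) ((hat_val x p i / (half_shift i - x))%:E *
     \sum_(r <oo) (((i + r).+1%:R - x)^-1 - (half_shift (i + r).+1 - x)^-1)%:E))%E.
  pose f i r := ((hat_val x p i / (half_shift i - x)) *
                ((r.+1%:R - x)^-1 - (half_shift r.+1 - x)^-1))%:E.
  transitivity (\sum_(r <oo) \sum_(0 <= i < r.+1) f i r)%E.
    apply: eq_eseriesr => r _; rewrite /f sumEFin; congr EFin.
    by rewrite mulrC mulr_suml.
  rewrite nneseries_triangle; last by move=> l i; rewrite lee_fin mulr_ge0.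
  apply: eq_eseriesr => i _; rewrite -nneseriesZl; last by move=> r _; rewrite lee_fin.
  by apply: eq_eseriesr => r _; rewrite -EFinM addnC.
rewrite -nneseries_binomial_value -nneseriesD; last 2 first.
- by move=> i _ _; rewrite mule_ge0 ?lee_fin // nneseries_ge0 // => r _ _; rewrite lee_fin.
- by move=> i _ _; rewrite mule_ge0 ?lee_fin // nneseries_ge0 // => r _ _; rewrite lee_fin.
apply: eq_eseriesr => i _; rewrite -ge0_muleDr; last 2 first.
- by rewrite nneseries_ge0 // => r _ _; rewrite lee_fin.
- by rewrite nneseries_ge0 // => r _ _; rewrite lee_fin.
rewrite nneseries_unit_diff -EFinM; congr EFin.
by field; rewrite gt_eqF.
Qed.

End real_identity.

(** * Comparison of coefficients *)

(** Values are extended reals, so that series with nonnegative coefficients can be rearranged before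
    anything is known about their convergence. *)
Definition power_sum {R : realType} (f : nat -> R) (x : R) : \bar R :=
  (\sum_(m <oo) (f m * x ^+ m)%:E)%E.

Lemma power_sum_ge0 (R : realType) (f : nat -> R) (x : R) :
  0 <= x -> (forall m, 0 <= f m) -> (0 <= power_sum f x)%E.
Proof.
by move=> x0 f0; apply: nneseries_ge0 => m _ _; rewrite lee_fin mulr_ge0 ?exprn_ge0.
Qed.

Lemma eq_power_sum (R : realType) (f g : nat -> R) (x : R) :
  f =1 g -> power_sum f x = power_sum g x.
Proof. by move=> fg; apply: eq_eseriesr => m _; rewrite fg. Qed.

Lemma power_sumS (R : realType) (f : nat -> R) (x : R) :
  0 <= x -> (forall m, 0 <= f m) ->
  power_sum f x = ((f 0%N)%:E + x%:E * power_sum (fun m => f m.+1) x)%E.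
Proof.
move=> x0 f0.
have fx0 m : (0 <= (f m * x ^+ m)%:E)%E by rewrite lee_fin mulr_ge0 ?exprn_ge0.
rewrite /power_sum nneseries_recl //; congr (_ + _)%E.
  by rewrite expr0 mulr1.
rewrite -(@nneseries_addn _ _ 1) // -nneseriesZl; last first.
  by move=> m _; rewrite lee_fin mulr_ge0 ?exprn_ge0.
by apply: eq_eseriesr => m _; rewrite addn1 -EFinM exprS mulrCA.
Qed.

Lemma power_sumZ (R : realType) (a : R) (f : nat -> R) (x : R) :
  0 <= x -> (forall m, 0 <= f m) ->
  power_sum (fun m => a * f m) x = (a%:E * power_sum f x)%E.
Proof.
move=> x0 f0; rewrite /power_sum -nneseriesZl.
  by apply: eq_eseriesr => m _; rewrite -EFinM mulrA.
by move=> m _; rewrite lee_fin mulr_ge0 ?exprn_ge0.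
Qed.

Lemma power_sum_sum (R : realType) (n : nat) (f : nat -> nat -> R) (x : R) :
  0 <= x -> (forall i m, 0 <= f i m) ->
  power_sum (fun m => \sum_(0 <= i < n) f i m) x =
  (\sum_(0 <= i < n) power_sum (f i) x)%E.
Proof.
move=> x0 f0; rewrite /power_sum -nneseries_sum_nat.
  by apply: eq_eseriesr => m _; rewrite mulr_suml sumEFin.
by move=> i m; rewrite lee_fin mulr_ge0 ?exprn_ge0.
Qed.

Lemma power_sumB (R : realType) (f g : nat -> R) (x a b : R) :
  0 <= x -> (forall m, 0 <= g m <= f m) ->
  power_sum f x = a%:E -> power_sum g x = b%:E ->
  power_sum (fun m => f m - g m) x = (a - b)%:E.
Proof.
move=> x0 fg fa gb.
have : (power_sum (fun m => f m - g m)%R x + power_sum g x = power_sum f x)%E.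
  rewrite /power_sum -nneseriesD.
  - by apply: eq_eseriesr => m _; rewrite -EFinD -mulrDl subrK.
  - by move=> m _ _; rewrite lee_fin mulr_ge0 ?exprn_ge0 ?subr_ge0; case/andP: (fg m).
  - by move=> m _ _; rewrite lee_fin mulr_ge0 ?exprn_ge0 //; case/andP: (fg m).
by rewrite fa gb EFinB => <-; rewrite addeK.
Qed.

Lemma nneseries_geometric (R : realType) (c x : R) : 0 <= x -> x < c ->
  (\sum_(j <oo) (x ^+ j / c ^+ j.+1)%:E = (c - x)^-1%:E)%E.
Proof.
move=> x0 xc; have c0 : 0 < c by exact: le_lt_trans xc.
have := nneseries_telescope R (fun j => (c - x)^-1 * (x / c) ^+ j).
rewrite expr0 mulr1 => <-.
  apply: eq_eseriesr => j _; congr EFin.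
  rewrite !exprMn !exprVn !exprS; field.
  by rewrite subr_eq0 !gt_eqF // exprn_gt0.
rewrite -[X in _ --> X](mulr0 (c - x)^-1).
apply: cvgM; first exact: cvg_cst.
apply: cvg_expr; rewrite ger0_norm; last by rewrite divr_ge0 // ltW.
by rewrite ltr_pdivrMr // mul1r.
Qed.

(** Cauchy product with the geometric series of 1/(c - x), justified by nonnegativity. *)
Lemma power_sum_div_coef (R : realType) (c x : R) (f : nat -> R) :
  0 <= x -> x < c -> (forall m, 0 <= f m) ->
  power_sum (div_coef c f) x = ((c - x)^-1%:E * power_sum f x)%E.
Proof.
move=> x0 xc f0; have c0 : 0 < c by exact: le_lt_trans xc.
transitivity (\sum_(m <oo) \sum_(0 <= d < m.+1)
   (f d / c ^+ (m - d).+1 * x ^+ m)%:E)%E.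
  by apply: eq_eseriesr => m _; rewrite sumEFin /div_coef mulr_suml.
rewrite (nneseries_triangle _ (fun d m => (f d / c ^+ (m - d).+1 * x ^+ m)%:E));
  last first.
  by move=> d m; rewrite lee_fin mulr_ge0 ?divr_ge0 ?exprn_ge0 // ltW.
rewrite /power_sum -nneseriesZl; last first.
  by move=> d _; rewrite lee_fin mulr_ge0 ?exprn_ge0.
apply: eq_eseriesr => d _.
rewrite muleC -nneseries_geometric // -nneseriesZl; last first.
  by move=> j _; rewrite lee_fin divr_ge0 ?exprn_ge0 // ltW.
apply: eq_eseriesr => j _; rewrite -EFinM addnK exprD; congr EFin.
by ring.
Qed.

(** * Generating functions of the three coefficient families *)

Lemma power_sum_hat_coef (R : realType) (p i : nat) (x : R) :
  0 <= x -> x < 1 -> power_sum (hat_coef p i) x = (hat_val x p i)%:E.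
Proof.
move=> x0 x1; elim: p i => [|p IH] i /=.
  rewrite power_sumS //= mulr1n.
  rewrite /= ?poch0 ?divr1 (_ : power_sum _ x = 0%E) ?mule0 ?adde0 //.
  by apply: eseries0 => m _ _; rewrite mul0r.
rewrite power_sum_sum //; last first.
  by move=> l m; apply: div_coef_ge0 => // d; exact: hat_coef_ge0.
rewrite -sumEFin; apply: eq_bigr => l _.
rewrite power_sum_div_coef ?IH -?EFinM 1?mulrC //; last exact: hat_coef_ge0.
by rewrite (lt_le_trans x1) // ler1n.
Qed.

Lemma tilde_coef_ge0 (R : realType) (p i m : nat) : 0 <= tilde_coef p i m :> R.
Proof.
have h : 0 <= half_shift i :> R by rewrite ltW // half_shift_gt0.
apply: div_coef_ge0 => // d; apply: div_coef_ge0 => // e; exact: hat_coef_ge0.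
Qed.

Lemma lt_half_shift (R : realType) (i : nat) (x : R) : x < 2^-1 -> x < half_shift i.
Proof. by move=> x12; rewrite (lt_le_trans x12) // lerDr. Qed.

Lemma power_sum_tilde_coef (R : realType) (p i : nat) (x : R) :
  0 <= x -> x < 2^-1 ->
  power_sum (tilde_coef p i) x = (hat_val x p i / (half_shift i - x) ^+ 2)%:E.
Proof.
move=> x0 x12; have xi := lt_half_shift R i x x12.
have h : 0 <= half_shift i :> R by rewrite ltW // half_shift_gt0.
rewrite power_sum_div_coef //; last first.
  by move=> m; apply: div_coef_ge0 => // e; exact: hat_coef_ge0.
rewrite power_sum_div_coef //; last exact: hat_coef_ge0.
rewrite power_sum_hat_coef //; last by move: x12; lra.
by rewrite -!EFinM; congr EFin; rewrite expr2 invfM; ring.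
Qed.

Lemma div_coef_le (R : realType) (b c : R) (f : nat -> R) (m : nat) :
  0 < b -> b <= c -> (forall m, 0 <= f m) -> div_coef c f m <= div_coef b f m.
Proof.
move=> b0 bc f0; have c0 : 0 < c by exact: lt_le_trans bc.
apply: ler_sum => d _; rewrite ler_wpM2l // lef_pV2 ?posrE ?exprn_gt0 //.
by rewrite lerXn2r // nnegrE ltW.
Qed.

(** Because r + 1 < r + 3/2, every difference in [bar_coef] is nonnegative, which brings B within
    reach of the Tonelli arguments. *)
Lemma bar_coef_term_ge0 (R : realType) (p r i m : nat) :
  0 <= (div_coef (half_shift r.+1) (div_coef (half_shift i) (hat_coef p i)) m : R)
    <= div_coef r.+1%:R (div_coef (half_shift i) (hat_coef p i)) m.
Proof.
have h j : 0 <= half_shift j :> R by rewrite ltW // half_shift_gt0.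
have c0 d : 0 <= div_coef (half_shift i) (hat_coef p i) d :> R.
  by apply: div_coef_ge0 => // e; exact: hat_coef_ge0.
by rewrite div_coef_ge0 //= div_coef_le // lerDl.
Qed.

Lemma bar_coef_ge0 (R : realType) (p r m : nat) : 0 <= bar_coef p r m :> R.
Proof.
apply: sumr_ge0 => i _; rewrite subr_ge0.
by case/andP: (bar_coef_term_ge0 R p r i m).
Qed.

Lemma power_sum_bar_coef (R : realType) (p r : nat) (x : R) :
  0 <= x -> x < 2^-1 ->
  power_sum (bar_coef p r) x =
  (((r.+1%:R - x)^-1 - (half_shift r.+1 - x)^-1) *
      \sum_(0 <= i < r.+1) hat_val x p i / (half_shift i - x))%:E.
Proof.
move=> x0 x12; have h j : 0 <= half_shift j :> R by rewrite ltW // half_shift_gt0.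
rewrite power_sum_sum //; last first.
  by move=> i m; rewrite subr_ge0; case/andP: (bar_coef_term_ge0 R p r i m).
rewrite mulr_sumr -sumEFin; apply: eq_bigr => i _; rewrite mulrBl.
have c0 d : 0 <= div_coef (half_shift i) (hat_coef p i) d :> R.
  by apply: div_coef_ge0 => // e; exact: hat_coef_ge0.
have E : power_sum (div_coef (half_shift i) (hat_coef p i)) x =
    (hat_val x p i / (half_shift i - x))%:E.
  rewrite power_sum_div_coef; [|done|exact: lt_half_shift|exact: hat_coef_ge0].
  rewrite power_sum_hat_coef //; last by move: x12; lra.
  by rewrite -EFinM mulrC.
apply: power_sumB => //.
- by move=> m; exact: bar_coef_term_ge0.
- rewrite power_sum_div_coef ?E //.
  by rewrite (lt_le_trans x12) // -[r.+1%:R]natr1; have := ler0n R r; lra.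
- rewrite power_sum_div_coef ?E //; exact: lt_half_shift.
Qed.

(** Separating the terms whose largest index is n + 1 gives Z_(n+1)(x) = (n+1)/(n+1-x) Z_n(x) for
    the generating functions in the depth m. *)
Lemma star_sum_div_coef (R : realType) (n : nat) :
  (fun m => star_sum m n.+1) =1
  div_coef n.+1%:R (fun m => n.+1%:R * star_sum m n : R).
Proof.
apply: div_coef_rec => [||m] //=.
by rewrite big_nat_recr //= mulrDr mulVKf.
Qed.

Lemma star_sum_ge0 (R : realType) (m n : nat) : 0 <= star_sum m n :> R.
Proof.
by elim: m n => [|m IH] n //=; rewrite sumr_ge0 // => l _; rewrite mulr_ge0.
Qed.

Lemma power_sum_star_sum (R : realType) (n : nat) (x : R) :
  0 <= x -> x < 1 ->
  power_sum (fun m => star_sum m n) x = (n`!%:R / poch (1 - x) n)%:E.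
Proof.
move=> x0 x1; elim: n => [|n IH].
  rewrite power_sumS //; last by move=> m; exact: star_sum_ge0.
  rewrite /= ?poch0 ?divr1 (_ : power_sum _ x = 0%E) ?mule0 ?adde0 //.
  by apply: eseries0 => m _ _; rewrite big_geq // mul0r.
rewrite (eq_power_sum _ _ _ _ (star_sum_div_coef R n)).
rewrite power_sum_div_coef //; first last.
- by move=> m; rewrite mulr_ge0 // star_sum_ge0.
- by rewrite (lt_le_trans x1) // ler1n.
rewrite power_sumZ //; last by move=> m; exact: star_sum_ge0.
rewrite IH -!EFinM pochS factS natrM invfM; congr EFin.
rewrite (_ : 1 - x + n%:R = n.+1%:R - x); last by rewrite -natr1; ring.
ring.
Qed.

Lemma central_binomialE (R : realType) (n : nat) :
  'C(2 * n, n)%:R / 4 ^+ n = poch 2^-1 n / n`!%:R :> R.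
Proof.
have H : (2 * n)`!%:R = 4 ^+ n * poch 2^-1 n * n`!%:R :> R.
  elim: n => [|n IH]; first by rewrite expr0 poch0 !mul1r.
  rewrite (_ : 2 * n.+1 = (2 * n).+2)%N; last by lia.
  rewrite !factS !natrM IH pochS exprS.
  rewrite -[(2 * n).+2%:R]natr1 -[(2 * n).+1%:R]natr1 natrM -[n.+1%:R]natr1.
  by field.
have := @bin_fact (2 * n) n; rewrite (_ : 2 * n - n = n)%N; last by lia.
rewrite leq_pmull // => /(_ isT) /(congr1 (fun k => k%:R : R)).
rewrite !natrM H => E.
have f0 : n`!%:R != 0 :> R by rewrite pnatr_eq0 -lt0n fact_gt0.
apply: (mulIf (x := n`!%:R * n`!%:R * 4 ^+ n)).
  by rewrite !mulf_neq0 // expf_neq0.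
transitivity ('C(2 * n, n)%:R * (n`!%:R * n`!%:R) : R).
  by field; rewrite expf_neq0.
by rewrite E; field.
Qed.

Definition binomial_term {R : realType} (m q n : nat) : R :=
  harmonic_number R n * star_sum m n * 'C(2 * n, n)%:R / (4 ^+ n * n%:R ^+ q).

Lemma harmonic_number_ge0 (R : realType) (n : nat) : 0 <= harmonic_number R n.
Proof. by rewrite sumr_ge0. Qed.

Lemma binomial_term_ge0 (R : realType) (m q n : nat) : 0 <= binomial_term m q n :> R.
Proof.
by rewrite divr_ge0 ?mulr_ge0 ?star_sum_ge0 ?harmonic_number_ge0 // exprn_ge0.
Qed.

Lemma power_sum_binomial_term (R : realType) (p N : nat) (x : R) :
  0 <= x -> x < 1 ->
  power_sum (fun m => binomial_term m p.+1 N.+1) x =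
  (harmonic_number R N.+1 * poch 2^-1 N.+1 /
      (poch (1 - x) N.+1 * N.+1%:R ^+ p.+1))%:E.
Proof.
move=> x0 x1; set n := N.+1.
pose a : R := harmonic_number R n * ('C(2 * n, n)%:R / 4 ^+ n) / n%:R ^+ p.+1.
rewrite (eq_power_sum _ _ (fun m => a * star_sum m n)); last first.
  by move=> m; rewrite /binomial_term /a invfM; ring.
rewrite power_sumZ //; last by move=> m; exact: star_sum_ge0.
rewrite power_sum_star_sum // -EFinM /a central_binomialE invfM; congr EFin.
have f0 : n`!%:R != 0 :> R by rewrite pnatr_eq0 -lt0n fact_gt0.
have P0 : poch (1 - x) n != 0 by rewrite gt_eqF // poch_gt0 // subr_gt0.
by field; rewrite f0 P0 expf_neq0 // pnatr_eq0.
Qed.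

(** By symmetry one inequality is enough: f(0) <= f(x) = g(x) = g(0) + x g'(x), where g' is the
    series of shifted coefficients. It satisfies g'(x) <= g'(r) = K < oo, so x K can be made
    arbitrarily small. *)
Lemma power_sum_head_eq (R : realType) (r : R) (a b : nat -> R) :
  0 < r -> (forall m, 0 <= a m) -> (forall m, 0 <= b m) ->
  (power_sum b r < +oo)%E ->
  (forall x, 0 < x <= r -> power_sum a x = power_sum b x) ->
  a 0%N = b 0%N.
Proof.
move=> r0.
suff H (f g : nat -> R) : (forall m, 0 <= f m) -> (forall m, 0 <= g m) ->
    (power_sum g r < +oo)%E ->
    (forall x, 0 < x <= r -> power_sum f x = power_sum g x) -> f 0%N <= g 0%N.
  move=> a0 b0 fin E; apply/eqP; rewrite eq_le; apply/andP; split; apply: H => //.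
    by rewrite E // r0 lexx.
  by move=> x xr; rewrite E.
move=> f0 g0 fin E.
pose g' m := g m.+1.
have gfin : (power_sum g' r < +oo)%E.
  move: fin; rewrite power_sumS //; last exact: ltW.
  have := @power_sum_ge0 R g' r (ltW r0) (fun m => g0 m.+1).
  rewrite -/g'; case: (power_sum g' r) => [y _ _|_|//]; first exact: ltry.
  by rewrite gt0_muley ?lte_fin.
have := @power_sum_ge0 R g' r (ltW r0) (fun m => g0 m.+1).
case Er: (power_sum g' r) gfin => [K| |] // _; rewrite lee_fin => K0.
apply/ler_addgt0Pr => e e0.
pose x := Num.min r (e / (K + 1)).
have K1 : 0 < K + 1 by rewrite ltr_wpDl.
have x0 : 0 < x by rewrite lt_min r0 divr_gt0.
have xr : x <= r by rewrite ge_min lexx.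
have xe : x * K <= e.
  apply: (@le_trans _ _ (x * (K + 1))).
    by rewrite mulrDr mulr1 lerDl ltW.
  by rewrite -ler_pdivlMr // ge_min lexx orbT.
have gx : (power_sum g' x <= K%:E)%E.
  rewrite -Er; apply: lee_nneseries => [m _ _|m _]; rewrite lee_fin.
    by apply: mulr_ge0; [exact: g0|rewrite exprn_ge0 // ltW].
  by apply: ler_wpM2l; [exact: g0|rewrite lerXn2r // nnegrE ltW].
have := E x; rewrite x0 xr => /(_ isT).
rewrite (power_sumS _ f) ?(power_sumS _ g) ?(ltW x0) // => Ex.
rewrite -lee_fin EFinD.
apply: (@le_trans _ _ ((g 0%N)%:E + x%:E * power_sum g' x)%E).
  rewrite -Ex leeDl //; apply: mule_ge0; first by rewrite lee_fin ltW.
  by apply: power_sum_ge0 => //; exact: ltW.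
rewrite leeD2l // (@le_trans _ _ (x%:E * K%:E)%E) ?lee_fin //.
by rewrite lee_pmul2l ?lte_fin.
Qed.

(** Equal constant terms are cancelled and the remaining identity is divided by x, which is possible
    since only x > 0 occur; then the induction hypothesis applies to the shifted coefficients. *)
Lemma power_sum_eq (R : realType) (r : R) (a b : nat -> R) :
  0 < r -> (forall m, 0 <= a m) -> (forall m, 0 <= b m) ->
  (power_sum b r < +oo)%E ->
  (forall x, 0 < x <= r -> power_sum a x = power_sum b x) ->
  a =1 b.
Proof.
move=> r0 + + + + m; elim: m a b => [|m IH] a b a0 b0 fin E.
  exact: power_sum_head_eq fin E.
have E0 := power_sum_head_eq _ _ _ _ r0 a0 b0 fin E.
apply: (IH (fun m => a m.+1) (fun m => b m.+1)) => //.
  move: fin; rewrite power_sumS //; last exact: ltW.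
  have := @power_sum_ge0 R (fun m => b m.+1) r (ltW r0) (fun m => b0 m.+1).
  case: (power_sum (fun m => b m.+1) r) => [y _ _|_|//]; first exact: ltry.
  by rewrite gt0_muley ?lte_fin.
move=> x /andP[x0 xr]; have := E x; rewrite x0 xr => /(_ isT).
rewrite (power_sumS _ a) ?(power_sumS _ b) ?(ltW x0) //.
rewrite E0 => /(congr1 (fun y => y - (b 0%N)%:E)%E).
rewrite ![((b 0%N)%:E + _)%E]addeC !addeK // => /(congr1 (fun y => (x^-1)%:E * y)%E).
by rewrite !muleA -EFinM mulVf ?gt_eqF // !mul1e.
Qed.

(** The coefficients here are themselves series and might be infinite. Since r^m > 0, a single
    infinite coefficient would make the sum at r infinite, so finiteness there reduces the claim to
    real coefficients. *)
Lemma nneseries_power_eq (R : realType) (r : R) (a b : nat -> \bar R) :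
  0 < r -> (forall m, 0 <= a m)%E -> (forall m, 0 <= b m)%E ->
  (\sum_(m <oo) b m * (r ^+ m)%:E < +oo)%E ->
  (forall x, 0 < x <= r ->
    (\sum_(m <oo) a m * (x ^+ m)%:E = \sum_(m <oo) b m * (x ^+ m)%:E)%E) ->
  forall m, a m = b m /\ (b m < +oo)%E.
Proof.
move=> r0 a0 b0 fin E.
have finE (f : nat -> \bar R) : (forall m, 0 <= f m)%E ->
    (\sum_(m <oo) f m * (r ^+ m)%:E < +oo)%E ->
    forall m, f m = (fine (f m))%:E.
  move=> f0 ffin m; rewrite fineK // ge0_fin_numE //.
  rewrite ltey; apply/eqP => Ef; move: ffin.
  rewrite (@nneseries_pinfty _ _ xpredT m) // => [n _|].
    by rewrite mule_ge0 // lee_fin exprn_ge0 // ltW.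
  by rewrite Ef gt0_mulye // lte_fin exprn_gt0.
have bE := finE b b0 fin.
have aE : forall m, a m = (fine (a m))%:E.
  by apply: finE => //; rewrite E // r0 lexx.
have psE (f : nat -> \bar R) x : (forall m, f m = (fine (f m))%:E) ->
    (\sum_(m <oo) f m * (x ^+ m)%:E)%E = power_sum (fine \o f) x.
  by move=> fE; apply: eq_eseriesr => m _; rewrite [f m]fE -EFinM.
move=> m; split; last by rewrite bE ltry.
rewrite aE bE; congr EFin; apply: (power_sum_eq R r (fine \o a) (fine \o b)) => //.
- by move=> k; apply: fine_ge0.
- by move=> k; apply: fine_ge0.
- by rewrite -psE.
- by move=> x xr; rewrite -!psE // E.
Qed.

(** * Square-root bounds and finiteness of T at 1/4 *)

Lemma sum_inv_sqrt_le (R : realType) (n : nat) :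
  \sum_(0 <= l < n) 2 / l.+1%:R * Num.sqrt l.+1%:R <= 4 * Num.sqrt n%:R :> R.
Proof.
elim: n => [|n IH]; first by rewrite big_geq // sqrtr0 mulr0.
rewrite big_nat_recr //=; apply: (le_trans (lerD IH (lexx _))).
set s := Num.sqrt n%:R; set t := Num.sqrt n.+1%:R.
have s0 : 0 <= s by exact: sqrtr_ge0.
have t0 : 0 < t by rewrite sqrtr_gt0.
have s2 : s ^+ 2 = n%:R by rewrite sqr_sqrtr.
have t2 : t ^+ 2 = s ^+ 2 + 1 by rewrite s2 natr1 sqr_sqrtr.
have -> : n.+1%:R = t ^+ 2 by rewrite sqr_sqrtr.
have -> : 2 / t ^+ 2 * t = 2 / t by field; rewrite gt_eqF.
rewrite -lerBrDl -mulrBr ler_pdivrMr //.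
have st : s <= t by rewrite ler_sqrt // ler_nat.
have E : (t - s) * (t + s) = 1 by rewrite -subr_sqr t2 addrAC subrr add0r.
(* The increment of the square root is t - s = 1/(t + s) >= 1/(2t), so four increments dominate the
   new term 2/t. *)
have : (t - s) * (t + s) <= (t - s) * (2 * t).
  by rewrite ler_wpM2l ?subr_ge0 // mulr_natl mulr2n lerD2l.
rewrite E; nra.
Qed.

(** Growth of order sqrt n is stable under summation with weights 2/n, at the cost of a factor 4 in
    the constant. This is the induction step for [hat_val_le] and [nested_sum_bound]. *)
Lemma sum_le_sqrt (R : realType) (C : R) (n : nat) (u v : nat -> R) :
  0 <= C -> (forall l, 0 <= u l <= 2 / l.+1%:R) ->
  (forall l, v l <= C * Num.sqrt l.+1%:R) ->
  \sum_(0 <= l < n) u l * v l <= 4 * C * Num.sqrt n.+1%:R.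
Proof.
move=> C0 u2 vC.
apply: (@le_trans _ _ (4 * C * Num.sqrt n%:R)); last first.
  by rewrite ler_wpM2l ?mulr_ge0 // ler_sqrt // ler_nat.
rewrite [4 * C]mulrC -mulrA.
apply: le_trans (ler_wpM2l C0 (sum_inv_sqrt_le R n)).
rewrite mulr_sumr; apply: ler_sum => l _; rewrite mulrCA.
have /andP[ul0 ul2] := u2 l.
apply: (le_trans (ler_wpM2l ul0 (vC l))).
by rewrite ler_wpM2r // mulr_ge0 // sqrtr_ge0.
Qed.

Lemma hat_val_le (R : realType) (x : R) (p i : nat) :
  0 <= x <= 2^-1 -> hat_val x p i <= 4 ^+ p * Num.sqrt i.+1%:R.
Proof.
move=> /andP[x0 x12]; elim: p i => [|p IH] i /=.
  by rewrite expr0 mul1r -[X in X <= _]sqrtr1 ler_sqrt // ler1n.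
rewrite exprS; under eq_bigr do rewrite mulrC.
apply: sum_le_sqrt; [by rewrite exprn_ge0|move=> l|exact: IH].
have lx : 0 < l.+1%:R - x.
  by rewrite -natr1; have := ler0n R l; move: x0 x12; lra.
rewrite invr_ge0 ltW //= -[2 / _]invf_div lef_pV2 ?posrE ?divr_gt0 //.
by rewrite -natr1; have := ler0n R l; move: x0 x12; lra.
Qed.

(* The decorations with nonnegative factor; a positive exponent bounds it by 2/n. *)
Definition half_even (e : entry) : bool :=
  match e with Hat s | Tilde s => (0 < s)%N | _ => false end.

Lemma entry_factor_bound (R : realType) (e : entry) (n : nat) :
  half_even e -> 0 <= entry_factor R e n.+1 <= 2 / n.+1%:R.
Proof.
have pw s : (0 < s)%N -> 0 <= ((n.+1%:R ^+ s)^-1 : R) <= n.+1%:R^-1.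
  move=> s0; rewrite invr_ge0 exprn_ge0 //= lef_pV2 ?posrE ?exprn_gt0 //.
  by rewrite -{1}[n.+1%:R]expr1 ler_weXn2l // ler1n.
have h (c : R) s : c = 0 \/ c = 2 -> (0 < s)%N ->
    0 <= c / n.+1%:R ^+ s <= 2 / n.+1%:R.
  move=> c02 /pw /andP[i0 i1]; case: c02 => ->.
    by rewrite mul0r lexx divr_ge0.
  by rewrite mulr_ge0 // ler_wpM2l.
have sgn k : (-1) ^+ k = 1 :> R \/ (-1) ^+ k = -1 :> R.
  elim: k => [|k [] IH]; first by left; rewrite expr0.
    by right; rewrite exprS IH mulr1.
  by left; rewrite exprS IH mulrNN mulr1.
case: e => //= s s0; apply: h => //; case: (sgn n.+1) => ->.
- by right.
- by left; rewrite subrr.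
- by left; rewrite subrr.
- by right; rewrite opprK.
Qed.

Lemma nested_sum_bound (R : realType) (s : seq entry) (N : nat) :
  all half_even s -> 0 <= (nested_sum s N : R) <= 4 ^+ size s * Num.sqrt N.+1%:R.
Proof.
elim: s N => [|e s IH] N /=.
  by rewrite ler01 expr0 mul1r -[X in X <= _]sqrtr1 ler_sqrt // ler1n.
move=> /andP[he hs]; apply/andP; split.
  apply: sumr_ge0 => n _; rewrite mulr_ge0 //.
    by case/andP: (entry_factor_bound R e n he).
  by case/andP: (IH n hs).
rewrite exprS; apply: sum_le_sqrt; first by rewrite exprn_ge0.
  by move=> n; exact: entry_factor_bound.
by move=> n; case/andP: (IH n hs).
Qed.

Lemma sqrt_inv_telescope_le (R : realType) (n : nat) :
  (n.+1%:R * Num.sqrt n.+1%:R)^-1 <=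
  6 * ((Num.sqrt n.+1%:R)^-1 - (Num.sqrt n.+2%:R)^-1) :> R.
Proof.
set s := Num.sqrt n.+1%:R; set t := Num.sqrt n.+2%:R.
have s0 : 0 < s by rewrite sqrtr_gt0.
have t0 : 0 < t by rewrite sqrtr_gt0.
have s1 : 1 <= s by rewrite -sqrtr1 ler_sqrt // ler1n.
have s2 : s ^+ 2 = n.+1%:R by rewrite sqr_sqrtr.
have t2 : t ^+ 2 = s ^+ 2 + 1 by rewrite s2 natr1 sqr_sqrtr.
have st : s <= t by rewrite ler_sqrt // ler_nat.
have ts : t <= 2 * s by rewrite -(ler_pXn2r (n := 2)) ?nnegrE ?ltW ?mulr_gt0 //; nra.
have E : (t - s) * (t + s) = 1 by rewrite -subr_sqr t2 addrAC subrr add0r.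
rewrite -s2 -subr_ge0.
have -> : 6 * (s^-1 - t^-1) - (s ^+ 2 * s)^-1 =
   (6 * s ^+ 2 * (t - s) - t) / (s ^+ 3 * t).
  by field; rewrite !gt_eqF.
rewrite divr_ge0 ?mulr_ge0 ?exprn_ge0 ?(ltW s0) ?(ltW t0) // subr_ge0.
have d0 : 0 <= t - s by rewrite subr_ge0.
have H : t = (t - s) * (t * (t + s)) by rewrite mulrCA E mulr1.
rewrite {1}H [X in _ <= X]mulrC ler_wpM2l //; nra.
Qed.

Lemma nneseries_hat_val_fin (R : realType) (p : nat) :
  (\sum_(i <oo) (hat_val 4^-1 p i / (half_shift i - 4^-1) ^+ 2)%:E
     < +oo :> \bar R)%E.
Proof.
(* The factors of [C] come from [hat_val_le], from i + 1/4 >= (i + 1)/4 squared, and from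
   [sqrt_inv_telescope_le]. The terms are of order (i + 1)^(-3/2) and are dominated by a telescoping
   series. *)
pose C : R := 4 ^+ p * 16 * 6; pose u (i : nat) : R := (Num.sqrt i.+1%:R)^-1.
have q0 : 0 <= 4^-1 :> R by rewrite invr_ge0.
have q1 : 4^-1 <= 2^-1 :> R by lra.
have q2 : 4^-1 < 2^-1 :> R by lra.
have C0 : 0 <= C by rewrite !mulr_ge0 // exprn_ge0.
have z0 (i : nat) : 0 < half_shift i - 4^-1 :> R.
  by rewrite /half_shift; have := ler0n R i; lra.
have t0 (i : nat) : 0 <= hat_val 4^-1 p i / (half_shift i - 4^-1) ^+ 2 :> R.
  by rewrite divr_ge0 ?exprn_ge0 ?(ltW (z0 i)) // hat_val_ge0.
have tu (i : nat) : hat_val 4^-1 p i / (half_shift i - 4^-1) ^+ 2 <= C * (u i - u i.+1).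
  have v0 : 0 < (i.+1%:R * Num.sqrt i.+1%:R : R) by rewrite mulr_gt0 ?sqrtr_gt0.
  apply: (@le_trans _ _ (4 ^+ p * 16 * (i.+1%:R * Num.sqrt i.+1%:R)^-1)); last first.
    by rewrite /C -[X in _ <= X]mulrA ler_wpM2l ?mulr_ge0 ?exprn_ge0 // sqrt_inv_telescope_le.
  have sq : Num.sqrt i.+1%:R ^+ 2 = i.+1%:R :> R by rewrite sqr_sqrtr.
  apply: (@le_trans _ _ (4 ^+ p * Num.sqrt i.+1%:R / (i.+1%:R / 4) ^+ 2)).
    apply: ler_pM => //; [exact: hat_val_ge0|by rewrite invr_ge0 exprn_ge0 // ltW| |].
      by rewrite hat_val_le // q0.
    rewrite lef_pV2 ?posrE ?exprn_gt0 // ?divr_gt0 //.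
    rewrite lerXn2r ?nnegrE ?divr_ge0 ?(ltW (z0 i)) //.
    by rewrite /half_shift -[i.+1%:R]natr1; have := ler0n R i; lra.
  rewrite le_eqVlt; apply/orP; left; apply/eqP.
  have s0 : Num.sqrt i.+1%:R != 0 :> R by rewrite gt_eqF // sqrtr_gt0.
  by move: (Num.sqrt _) sq s0 => s <- s0; field.
apply: (@le_lt_trans _ _ C%:E); last exact: ltry.
apply: lime_le; first by apply: is_cvg_nneseries => i _ _; rewrite lee_fin.
near=> n; rewrite sumEFin lee_fin.
apply: (le_trans (ler_sum_nat (fun i _ => tu i))).
rewrite -mulr_sumr -[X in _ <= X]mulr1 ler_wpM2l //.
rewrite -[X in X <= _]opprK -sumrN (eq_bigr _ (fun k _ => opprB _ _)).
rewrite telescope_sumr // opprB /u sqrtr1 invr1 gerBl.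
by rewrite invr_ge0 sqrtr_ge0.
Unshelve. all: by end_near. Qed.

Lemma nneseries_power_interchange (R : realType) (f : nat -> nat -> R) (x : R) :
  0 <= x -> (forall N m, 0 <= f N m) ->
  (\sum_(m <oo) (\sum_(N <oo) (f N m)%:E) * (x ^+ m)%:E =
   \sum_(N <oo) power_sum (f N) x)%E.
Proof.
move=> x0 f0; rewrite [RHS]nneseries_interchange; last first.
  by move=> i j; rewrite lee_fin mulr_ge0 ?exprn_ge0.
apply: eq_eseriesr => m _; rewrite muleC -nneseriesZl; last first.
  by move=> N _; rewrite lee_fin.
by apply: eq_eseriesr => N _; rewrite -EFinM mulrC.
Qed.

Lemma nneseries_coef_identity (R : realType) (p m : nat) :
  (\sum_(N <oo) (binomial_term m p.+1 N.+1)%:E + \sum_(r <oo) (bar_coef p r m)%:E =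
   \sum_(i <oo) (tilde_coef p i m)%:E :> \bar R)%E /\
  (\sum_(i <oo) (tilde_coef p i m)%:E < +oo :> \bar R)%E.
Proof.
have L0 k : (0 <= \sum_(N <oo) (binomial_term k p.+1 N.+1)%:E :> \bar R)%E.
  by apply: nneseries_ge0 => N _ _; rewrite lee_fin binomial_term_ge0.
have B0 k : (0 <= \sum_(r <oo) (bar_coef p r k)%:E :> \bar R)%E.
  by apply: nneseries_ge0 => r _ _; rewrite lee_fin bar_coef_ge0.
have T0 k : (0 <= \sum_(i <oo) (tilde_coef p i k)%:E :> \bar R)%E.
  by apply: nneseries_ge0 => i _ _; rewrite lee_fin tilde_coef_ge0.
have q12 : 4^-1 < 2^-1 :> R by lra.
have TE (x : R) : 0 <= x -> x < 2^-1 ->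
    (\sum_(m <oo) (\sum_(i <oo) (tilde_coef p i m)%:E) * (x ^+ m)%:E =
     \sum_(i <oo) (hat_val x p i / (half_shift i - x) ^+ 2)%:E)%E.
  move=> x0 x12; rewrite nneseries_power_interchange //; last exact: tilde_coef_ge0.
  by apply: eq_eseriesr => i _; rewrite power_sum_tilde_coef.
apply: (nneseries_power_eq R 4^-1 (fun k =>
    \sum_(N <oo) (binomial_term k p.+1 N.+1)%:E + \sum_(r <oo) (bar_coef p r k)%:E)%E
  (fun k => \sum_(i <oo) (tilde_coef p i k)%:E)%E) => //.
- by move=> k; rewrite adde_ge0.
- by rewrite TE ?invr_ge0 //; exact: nneseries_hat_val_fin.
move=> x /andP[/ltW x0 xq]; have x12 : x < 2^-1 by exact: le_lt_trans q12.
have x1 : x < 1 by move: x12; lra.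
rewrite TE // -nneseries_real_identity //.
transitivity (\sum_(m <oo) ((\sum_(N <oo) (binomial_term m p.+1 N.+1)%:E) * (x ^+ m)%:E +
   (\sum_(r <oo) (bar_coef p r m)%:E) * (x ^+ m)%:E))%E.
  by apply: eq_eseriesr => k _; rewrite ge0_muleDl.
rewrite nneseriesD; last 2 first.
- by move=> k _ _; rewrite mule_ge0 // lee_fin exprn_ge0.
- by move=> k _ _; rewrite mule_ge0 // lee_fin exprn_ge0.
rewrite (nneseries_power_interchange _ (fun N m => binomial_term m p.+1 N.+1)) //;
  last by move=> N k; exact: binomial_term_ge0.
rewrite nneseries_power_interchange //; last exact: bar_coef_ge0.
congr (_ + _)%E; apply: eq_eseriesr => N _.
  by rewrite power_sum_binomial_term.
by rewrite power_sum_bar_coef.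
Qed.

(** * Convergence of the zeta values *)

Lemma nneseries_cvg_series (R : realType) (u : nat -> R) :
  (forall n, 0 <= u n) -> (\sum_(n <oo) (u n)%:E < +oo)%E ->
  (fun n => \sum_(0 <= k < n) u k) @ \oo --> fine (\sum_(n <oo) (u n)%:E)%E.
Proof.
move=> u0 ufin.
have U0 : (0 <= \sum_(n <oo) (u n)%:E)%E.
  by apply: nneseries_ge0 => n _ _; rewrite lee_fin.
have : (fun n => \sum_(0 <= k < n) (u k)%:E)%E @ \oo -->
    (fine (\sum_(n <oo) (u n)%:E)%E)%:E.
  rewrite fineK ?ge0_fin_numE //.
  by apply: is_cvg_nneseries => n _ _; rewrite lee_fin.
move/fine_cvg; apply: cvg_trans; apply: near_eq_cvg; near=> n.
by rewrite /= sumEFin.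
Unshelve. all: by end_near. Qed.

(** L and B are nonnegative with sum T < oo, so all three are finite and the extended identity
    descends to real limits. *)
Lemma coef_identity (R : realType) (p m : nat) :
  exists L B T : R,
  [/\ (fun n => \sum_(0 <= k < n) binomial_term m p.+1 k.+1) @ \oo --> L,
      (fun n => \sum_(0 <= r < n) bar_coef p r m) @ \oo --> B,
      (fun n => \sum_(0 <= i < n) tilde_coef p i m) @ \oo --> T &
      L + B = T].
Proof.
have [E Tfin] := nneseries_coef_identity R p m.
have L0 : (0 <= \sum_(N <oo) (binomial_term m p.+1 N.+1)%:E :> \bar R)%E.
  by apply: nneseries_ge0 => N _ _; rewrite lee_fin binomial_term_ge0.
have B0 : (0 <= \sum_(r <oo) (bar_coef p r m)%:E :> \bar R)%E.
  by apply: nneseries_ge0 => r _ _; rewrite lee_fin bar_coef_ge0.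
have Lfin : (\sum_(N <oo) (binomial_term m p.+1 N.+1)%:E < +oo :> \bar R)%E.
  by apply: le_lt_trans Tfin; rewrite -E leeDl.
have Bfin : (\sum_(r <oo) (bar_coef p r m)%:E < +oo :> \bar R)%E.
  by apply: le_lt_trans Tfin; rewrite -E leeDr.
exists (fine (\sum_(N <oo) (binomial_term m p.+1 N.+1)%:E)%E),
  (fine (\sum_(r <oo) (bar_coef p r m)%:E)%E), (fine (\sum_(i <oo) (tilde_coef p i m)%:E)%E).
split; [apply: (nneseries_cvg_series _ (fun k => binomial_term m p.+1 k.+1)) => // n;
    exact: binomial_term_ge0
  |apply: nneseries_cvg_series => // n; exact: bar_coef_ge0
  |apply: nneseries_cvg_series => // n; exact: tilde_coef_ge0|].
by rewrite -fineD ?ge0_fin_numE // E.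
Qed.

Lemma nested_sum_homo (R : realType) (e : entry) (s : seq entry) :
  all half_even (e :: s) ->
  {homo nested_sum (e :: s) : N M / (N <= M)%N >-> N <= M :> R}.
Proof.
move=> /= /andP[he hs]; apply/nondecreasing_seqP => n /=.
rewrite big_nat_recr //= lerDl mulr_ge0 //.
  by case/andP: (entry_factor_bound R e n he).
by case/andP: (nested_sum_bound R s n hs).
Qed.

Lemma cvg_double : (fun n => n.*2) @ \oo --> \oo.
Proof. by apply/cvgnyPge => A; exists A => // n /= An; lia. Qed.

Lemma cvg_doubleS : (fun n => n.*2.+1) @ \oo --> \oo.
Proof. by apply/cvgnyPge => A; exists A => // n /= An; lia. Qed.

Lemma cvg_half : (fun n => n./2) @ \oo --> \oo.
Proof. by apply/cvgnyPge => A; exists A.*2 => // n /= An; lia. Qed.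

Lemma cvg_inv_sqrt (R : realType) :
  (fun n => (Num.sqrt n.+1%:R)^-1) @ \oo --> (0 : R).
Proof.
have -> : (fun n => (Num.sqrt n.+1%:R)^-1) = Num.sqrt \o @harmonic R.
  by apply/funext => n /=; rewrite sqrtrV.
rewrite -[X in _ --> X]sqrtr0; apply: continuous_cvg; last exact: cvg_harmonic.
exact: sqrt_continuous.
Qed.

Lemma nested_sum_bar_cvg (R : realType) (k : nat) (t : seq entry) (C l : R) :
  (forall n, 0 <= (nested_sum t n : R) <= C * Num.sqrt n.+1%:R) ->
  (fun M => nested_sum (Bar k.+1 :: t) M.*2.+1) @ \oo --> l ->
  nested_sum (Bar k.+1 :: t) @ \oo --> l.
Proof.
set u := nested_sum (Bar k.+1 :: t) => tC ul; rewrite -cvg_shiftS.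
(* [(n./2).*2.+1] is the largest odd number not exceeding n + 1. Hence u at n + 1 differs from u
   there by nothing, or by one last term of size at most C/sqrt(n + 1). *)
have ul2 : (fun n => u (n./2).*2.+1) @ \oo --> l.
  exact: (cvg_comp _ _ cvg_half ul).
have d0 : (fun n => u n.+1 - u (n./2).*2.+1) @ \oo --> (0 : R).
  have C0 : (fun n => C * (Num.sqrt n.+1%:R)^-1) @ \oo --> (0 : R).
    by rewrite -[X in _ --> X](mulr0 C); apply: cvgM; [exact: cvg_cst|exact: cvg_inv_sqrt].
  apply/cvgr0Pnorm_le => e e0.
  move/cvgr0Pnorm_le : C0 => /(_ _ e0); apply: filterS => n; apply: le_trans.
  have nC : 0 <= C * (Num.sqrt n.+1%:R)^-1.
    have /andP[a b] := tC n.
    have := le_trans a b; rewrite pmulr_lge0 ?sqrtr_gt0 // => C0'.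
    by rewrite mulr_ge0 // invr_ge0 sqrtr_ge0.
  rewrite [X in _ <= X]ger0_norm //.
  have := odd_double_half n; case: odd => /= nE; last first.
    by rewrite -[X in u X.+1]nE subrr normr0.
  have nE' : (n./2.*2.+1 = n)%N by lia.
  rewrite nE' /u /= big_nat_recr //= [X in `|X - _|]addrC addrK.
  rewrite !normrM normfV normrX normrN1 expr1n mul1r.
  have /andP[a b] := tC n.
  rewrite (ger0_norm a) ger0_norm ?exprn_ge0 //.
  have s0 : 0 < Num.sqrt n.+1%:R :> R by rewrite sqrtr_gt0.
  have sq : Num.sqrt n.+1%:R ^+ 2 = n.+1%:R :> R by rewrite sqr_sqrtr.
  have -> : C * (Num.sqrt n.+1%:R)^-1 = n.+1%:R^-1 * (C * Num.sqrt n.+1%:R).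
    by rewrite -{2}sq; field; rewrite gt_eqF.
  apply: ler_pM => //.
  rewrite lef_pV2 ?posrE ?exprn_gt0 //.
  by rewrite -{1}[n.+1%:R]expr1 ler_weXn2l // ler1n.
have -> : [sequence u n.+1]_n = (fun n => (u n.+1 - u (n./2).*2.+1) + u (n./2).*2.+1).
  by apply/funext => n /=; rewrite subrK.
by rewrite -[l]add0r; apply: cvgD.
Qed.

Lemma cvg_finite_sum (R : realType) (I : Type) (r : seq I) (P : pred I)
    (f : I -> nat -> R) (a : I -> R) :
  (forall i, P i -> f i @ \oo --> a i) ->
  (fun n => \sum_(i <- r | P i) f i n) @ \oo --> \sum_(i <- r | P i) a i.
Proof.
move=> fa; elim: r => [|i r IH].
  rewrite big_nil; under eq_fun do rewrite big_nil; exact: cvg_cst.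
rewrite big_cons; under eq_fun do rewrite big_cons.
by case: ifPn => // Pi; apply: cvgD => //; exact: fa.
Qed.

Lemma binomial_partialE (R : realType) (m q N : nat) :
  binomial_partial R m q N = \sum_(0 <= k < N) binomial_term m q k.+1.
Proof.
rewrite /binomial_partial big_add1 /=; apply: eq_bigr => k _.
by rewrite zeta_star_onesE.
Qed.

Lemma half_even_hat (b l : nat) (k : seq 'I_b.+1) :
  all (fun i : 'I_b.+1 => 0 < i)%N k ->
  all half_even [seq Hat (nat_of_ord i) | i <- take l k].
Proof.
by move=> /allP k0; rewrite all_map; apply/allP => i /mem_take /k0.
Qed.

Lemma mzv_partial_fun (R : realType) (s : seq entry) :
  mzv_partial R s = nested_sum s.
Proof. by apply/funext => N; exact: mzv_partialE. Qed.

(** A tilde word has nondecreasing partial sums. All words in [sum_tilde_word] are nonnegative and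
    each has weight at least 1, since |k|_p <= w - 2, so a single one is bounded by T / 2^(m+1). *)
Lemma tilde_word_cvg (R : realType) (m p w b : nat) (k : p.-tuple 'I_b.+1) :
  w = (m + p + 2)%N -> b = (w - 2)%N -> bounded_composition k ->
  mzv_converges R (tilde_word w k).
Proof.
move=> wE bE kb; have [L [B [T [_ _ Tcvg _]]]] := coef_identity R p m.
have kP : forall j : p.-tuple 'I_b.+1, bounded_composition j ->
    (part_sum j <= b)%N /\ all half_even (tilde_word w j).
  move=> j /andP[j0 jb]; split => //=.
  by rewrite -{1}(take_size j) half_even_hat // andbT; lia.
have [kle hk] := kP k kb.
rewrite /mzv_converges mzv_partial_fun.
have mono := nested_sum_homo R _ _ hk.
have Tle n : \sum_(0 <= i < n) tilde_coef p i m <= T.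
  rewrite -(cvg_lim _ Tcvg) //; apply: nondecreasing_cvgn_le; last by apply/cvg_ex; exists T.
  by apply/nondecreasing_seqP => i; rewrite big_nat_recr //= lerDl tilde_coef_ge0.
apply: nondecreasing_is_cvgn => //; exists (T / 2 ^+ (m + 1)) => _ [N _ <-].
apply: (@le_trans _ _ (nested_sum (tilde_word w k) N.*2)); first by apply: mono; lia.
rewrite ler_pdivlMr ?exprn_gt0 // mulrC.
apply: le_trans (Tle N); rewrite -(sum_tilde_word _ w b) //.
rewrite ler_wpM2l ?exprn_ge0 // (bigD1 k) //=.
apply: (@le_trans _ _ ((w - 1 - part_sum k)%:R * nested_sum (tilde_word w k) N.*2)).
  have [n0 _] := andP (nested_sum_bound R _ N.*2 hk).
  by rewrite ler_peMl // ler1n; lia.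
rewrite lerDl sumr_ge0 // => j /andP[jb _]; rewrite mulr_ge0 //.
have [_ hj] := kP j jb.
by have [] := andP (nested_sum_bound R _ N.*2 hj).
Qed.

(** Monotonicity and nonnegativity hold along odd bounds, where the signed terms are paired. There
    each word is bounded by the whole sum, hence by B / 2^(m+1), and [nested_sum_bar_cvg] passes to
    all bounds. *)
Lemma bar_word_cvg (R : realType) (m p w b : nat) (k : p.+1.-tuple 'I_b.+1) :
  w = (m + p + 2)%N -> b = (w - 1)%N -> bounded_composition k ->
  mzv_converges R (bar_word w k).
Proof.
move=> wE bE kb; have [L [B [T [_ Bcvg _ _]]]] := coef_identity R p m.
have Ble n : \sum_(0 <= r < n) bar_coef p r m <= B.
  rewrite -(cvg_lim _ Bcvg) //; apply: nondecreasing_cvgn_le; last by apply/cvg_ex; exists B.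
  by apply/nondecreasing_seqP => i; rewrite big_nat_recr //= lerDl bar_coef_ge0.
have kP : forall j : p.+1.-tuple 'I_b.+1, bounded_composition j ->
    exists q t, [/\ bar_word w j = Bar q.+1 :: t, all half_even t,
      {homo (fun M => nested_sum (Bar q.+1 :: t) M.*2.+1) : N M / (N <= M)%N >-> N <= M :> R}
      & 0 <= nested_sum (Bar q.+1 :: t) 1 :> R].
  move=> j /andP[j0 jb]; set t := Tilde (w - part_sum j) ::
    [seq Hat (nat_of_ord i) | i <- take p j].
  have ht : all half_even t by rewrite /= half_even_hat // andbT; lia.
  have q0 : (0 < tnth j ord_max)%N by exact: (allP j0 _ (mem_tnth _ _)).
  have t0 : nested_sum t 0 = 0 :> R by rewrite /= big_geq.
  have ts i : nested_sum t i.+1.*2 = nested_sum t i.*2.+1 :> R.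
    exact: nested_sum_tilde_odd.
  exists (tnth j ord_max).-1, t; split => //.
  - by rewrite /bar_word prednK.
  - apply/nondecreasing_seqP => M; rewrite !nested_sum_bar //.
    rewrite big_nat_recr //= lerDl divr_ge0 ?exprn_ge0 // mulr_ge0 //.
      rewrite subr_ge0 lef_pV2 ?posrE ?exprn_gt0 ?half_shift_gt0 //.
      by rewrite lerXn2r ?nnegrE ?addr_ge0 // lerDl.
    by have [] := andP (nested_sum_bound R _ M.+1.*2 ht).
  - by rewrite (nested_sum_bar _ _ _ 0) // big_geq.
have [q [t [kE ht mono _]]] := kP k kb.
rewrite /mzv_converges mzv_partial_fun kE.
suff /cvg_ex[l ul] : cvgn (fun M => nested_sum (Bar q.+1 :: t) M.*2.+1 : R).
  apply/cvg_ex; exists l; apply: (nested_sum_bar_cvg _ _ _ (4 ^+ size t)) => // n.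
  exact: nested_sum_bound.
apply: nondecreasing_is_cvgn => //; exists (B / 2 ^+ (m + 1)) => _ [M _ <-].
rewrite ler_pdivlMr ?exprn_gt0 // mulrC.
apply: le_trans (Ble M); rewrite -(sum_bar_word _ w b) //.
rewrite ler_wpM2l ?exprn_ge0 // (bigD1 k) // kE lerDl sumr_ge0 // => j /andP[jb _].
have [q' [t' [-> _ mono' n0]]] := kP j jb.
exact: le_trans n0 (mono' 0%N M (leq0n M)).
Qed.

(** This covers [p = 0] as well, so both identities of the theorem are instances. The bounds enter
    through equations, so that any expression equal to them fits. *)
Lemma binomial_partial_cvg (R : realType) (m p w b b' : nat) :
  w = (m + p + 2)%N -> b = (w - 1)%N -> b' = (w - 2)%N ->
  binomial_partial R m p.+1 @ \oo -->
     - 2 ^+ (m + 1) *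
         \sum_(k : p.+1.-tuple 'I_b.+1 | bounded_composition k)
           mzv R (bar_word w k)
     + 2 ^+ (m + 1) *
         \sum_(k : p.-tuple 'I_b'.+1 | bounded_composition k)
           (w - 1 - part_sum k)%:R * mzv R (tilde_word w k).
Proof.
move=> wE bE bE'; have [L [B [T [Lcvg Bcvg Tcvg LBT]]]] := coef_identity R p m.
have mzvE s : mzv_converges R s -> nested_sum s @ \oo --> mzv R s.
  by rewrite /mzv_converges /mzv mzv_partial_fun.
rewrite mulNr.
have <- : B = 2 ^+ (m + 1) * \sum_(k : p.+1.-tuple 'I_b.+1 | bounded_composition k)
           mzv R (bar_word w k).
  apply: (cvg_unique _ Bcvg); first by [].
  rewrite (_ : (fun n => _) = fun M => 2 ^+ (m + 1) *
     \sum_(k : p.+1.-tuple 'I_b.+1 | bounded_composition k)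
        nested_sum (bar_word w k) M.*2.+1); last first.
    by apply/funext => M; rewrite (sum_bar_word _ w b).
  apply: cvgM; first exact: cvg_cst.
  apply: cvg_finite_sum => k kb.
  have := mzvE _ (bar_word_cvg R m p w b k wE bE kb).
  by move/(cvg_comp _ _ cvg_doubleS).
have <- : T = 2 ^+ (m + 1) * \sum_(k : p.-tuple 'I_b'.+1 | bounded_composition k)
           (w - 1 - part_sum k)%:R * mzv R (tilde_word w k).
  apply: (cvg_unique _ Tcvg); first by [].
  rewrite (_ : (fun n => _) = fun N => 2 ^+ (m + 1) *
     \sum_(k : p.-tuple 'I_b'.+1 | bounded_composition k)
        (w - 1 - part_sum k)%:R * nested_sum (tilde_word w k) N.*2); last first.
    by apply/funext => N; rewrite (sum_tilde_word _ w b').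
  apply: cvgM; first exact: cvg_cst.
  apply: cvg_finite_sum => k kb; apply: cvgM; first exact: cvg_cst.
  have := mzvE _ (tilde_word_cvg R m p w b' k wE bE' kb).
  by move/(cvg_comp _ _ cvg_double).
rewrite -LBT addrC addrK (_ : binomial_partial R m p.+1 =
  fun n => \sum_(0 <= k < n) binomial_term m p.+1 k.+1) //.
by apply/funext => n; exact: binomial_partialE.
Qed.

Theorem theorem2p9 (R : realType) (m p : nat) (hp : (1 <= p)%N) :
  let w := (m + p + 2)%N in
  (* convergence of the zeta values, presupposed by the two identities *)
  [/\ forall k : nat, (1 <= k <= m + 1)%N ->
        mzv_converges R [:: Bar k; Tilde (m + 2 - k)],
      mzv_converges R [:: Tilde (m + 2)],
      forall k : p.+1.-tuple 'I_(w - 1).+1, bounded_composition k ->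
        mzv_converges R (bar_word w k)
    & forall k : p.-tuple 'I_(w - 2).+1, bounded_composition k ->
        mzv_converges R (tilde_word w k)]
  /\
  (binomial_partial R m 1 @ \oo -->
     - 2%:R ^+ (m + 1) *
         \sum_(1 <= k < m + 2) mzv R [:: Bar k; Tilde (m + 2 - k)]
     + 2%:R ^+ (m + 1) * (m + 1)%:R * mzv R [:: Tilde (m + 2)])
  /\
  (binomial_partial R m (p + 1) @ \oo -->
     - 2%:R ^+ (m + 1) *
         \sum_(k : p.+1.-tuple 'I_(w - 1).+1 | bounded_composition k)
           mzv R (bar_word w k)
     + 2%:R ^+ (m + 1) *
         \sum_(k : p.-tuple 'I_(w - 2).+1 | bounded_composition k)
           (w - 1 - part_sum k)%:R * mzv R (tilde_word w k)).
Proof.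
move=> w.
(* The first identity is [binomial_partial_cvg] with zero in place of [p]: the weight is [m + 2],
   the bounds are [m + 1] and [m]. *)
have w0 : (m + 2 = m + 0 + 2)%N by rewrite addn0.
have m1 : (m + 1 = m + 2 - 1)%N by lia.
have m0 : (m = m + 2 - 2)%N by lia.
have bar1 (k : 1.-tuple 'I_(m + 1).+1) :
    bar_word (m + 2) k = [:: Bar (thead k); Tilde (m + 2 - thead k)].
  rewrite /bar_word take0 /part_sum; case/tupleP: k => x t.
  by rewrite (tuple0 t) /thead !(tnth_nth x) /= big_seq1.
have tilde0 (k : 0.-tuple 'I_m.+1) :
    tilde_word (m + 2) k = [:: Tilde (m + 2)] /\ part_sum k = 0%N.
  by rewrite /tilde_word /part_sum tuple0 /= big_nil subn0.
split.
  split.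
  - move=> k km; pose t : 1.-tuple 'I_(m + 1).+1 := [tuple inord k].
    have tE : thead t = k :> nat by rewrite /thead /= inordK; lia.
    rewrite -tE -bar1; apply: (bar_word_cvg R m 0) => //.
    rewrite /bounded_composition /part_sum /= big_seq1 inordK; lia.
  - rewrite -(tilde0 [tuple]).1; apply: (tilde_word_cvg R m 0) => //.
    by rewrite /bounded_composition (tilde0 _).2.
  - by move=> k; exact: bar_word_cvg.
  - by move=> k; exact: tilde_word_cvg.
split; last by rewrite addn1; exact: binomial_partial_cvg.
have := binomial_partial_cvg R m 0 _ _ _ w0 m1 m0.
(* Without hats the empty tuple is the only index of the tilde sum, and its weight is [m + 1]. *)
rewrite (big_pred1 [tuple]) => [|k]; last first.
  by rewrite tuple0 /bounded_composition (tilde0 _).2; exact/esym/eqxx.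
rewrite (tilde0 _).1 (tilde0 _).2 subn0 -m1 mulrA.
pose F s := mzv R [:: Bar (head 0%N s); Tilde (m + 2 - sumn s)].
rewrite [X in _ * X + _](_ : _ = \sum_(1 <= k < m + 2)
    mzv R [:: Bar k; Tilde (m + 2 - k)]) //.
transitivity (\sum_(k : 1.-tuple 'I_(m + 1).+1 |
  all (fun i : 'I_(m + 1).+1 => 0 < i)%N k && (part_sum k <= 1 + m)%N) F (map val k)).
  apply: eq_big => [k|k _]; first by rewrite /bounded_composition [(1 + m)%N]addnC.
  rewrite bar1; case/tupleP: k => x t.
  by rewrite (tuple0 t) /F /thead !(tnth_nth x) /= addn0.
rewrite sum_bounded_composition; last by rewrite addnC.
rewrite [RHS]big_add1 (_ : (m + 2).-1 = m.+1); last by lia.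
(* A composition with one part and excess [d] is the single entry [d.+1]: in [comp_sum 1 d] only the
   remaining excess 0 contributes. *)
apply: eq_big_nat => d _; rewrite /= big_ltn // big_nat big1 => [|e].
  by rewrite /F /= subn0 !addn0 addr0.
by case: e.
Qed.
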